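(* Let $H(x,p)=\sigma(x)m(|p|)$ for $(x,p)\in\mathbf{T}^N\times\mathbf{R}^N$, where $\sigma:\mathbf{T}^N\to(0,\infty)$ is continuous, $m:[0,\infty)\to(0,1)$ is Lipschitz continuous and strictly increasing, and $m(r)\to1$ as $r\to\infty$. Let $\underline{\sigma}=\min_{\mathbf{T}^N}\sigma$, let $\bar{H}_\infty$ be the generalized effective Hamiltonian of $H$ and let $\mathcal{D}$ be the solvability set of $H$. Then $$\mathcal{D}=\{P\in\mathbf{R}^N\mid\bar{H}_\infty(P)<\underline{\sigma}\}.$$ Moreover, if $P\in\mathcal{D}$, then the critical value of the cell problem $H(x,Du(x)+P)=a$ in $\mathbf{T}^N$ is equal to $\bar{H}_\infty(P)$.
   Context: $\mathbf{T}^N=\mathbf{R}^N/\mathbf{Z}^N$; functions on $\mathbf{T}^N$ are identified with $\mathbf{Z}^N$-periodic functions on $\mathbf{R}^N$. $\mathrm{Lip}(\mathbf{T}^N)$ is the set of Lipschitz continuous functions on $\mathbf{T}^N$. $\overline{B(x,r)}$ is the closed ball of radius $r$ centered at $x$. Viscosity solutions: for continuous $F:\mathbf{T}^N\times\mathbf{R}^N\to\mathbf{R}$ and $u\in C(\mathbf{T}^N)$, let $D^+u(x)$ (resp. $D^-u(x)$) be the set of $D\phi(x)$ with $\phi\in C^1(\mathbf{T}^N)$ such that $u-\phi$ attains its maximum (resp. minimum) over $\mathbf{T}^N$ at $x$. $u$ is a subsolution (resp. supersolution) of $F(x,Du)=0$ in $\mathbf{T}^N$ if $F(\hat x,p)\le0$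 for all $\hat x$ and $p\in D^+u(\hat x)$ (resp. $F(\hat x,p)\ge0$ for all $\hat x$ and $p\in D^-u(\hat x)$); it is a solution if it is both. The equation $G(x,Du+P)=a$ is understood with $F(x,p)=G(x,p+P)-a$. Cell problem: for given $P\in\mathbf{R}^N$, a solution of the cell problem $H(x,Du(x)+P)=a$ in $\mathbf{T}^N$ is a pair $(u,a)\in\mathrm{Lip}(\mathbf{T}^N)\times\mathbf{R}$ such that $u$ is a viscosity solution of this equation. If a solution exists, the constant $a$ is unique and is called the critical value. The solvability set $\mathcal{D}$ is the set of $P\in\mathbf{R}^N$ for which the cell problem admits a solution. Generalized effective Hamiltonian: consider sequences of functions $H_n:\mathbf{T}^N\times\mathbf{R}^N\to\mathbf{R}$ such that (A1) each $H_n$ is continuous; (A2) each $H_n$ is coercive: $\lim_{r\to\infty}\inf\{H_n(x,p)\mid x\in\mathbf{T}^N,\ |p|\ge r\}=+\infty$; (A3) $\liminf_{n\to\infty}\inf_{\mathbf{T}^N\times\overline{B(0,R)}}(H-H_n)\ge0$ for all $R>0$; (A4) $\limsup_{n\to\infty}\sup_{\mathbf{T}^N\times\mathbf{R}^N}(H-H_n)\le0$. For coercive continuous $H_n$ and each $P\in\mathbf{R}^N$ there is a unique constant $\bar{H}_n(P)$ (the effective Hamiltonian of $H_n$ at $P$) for which $H_n(x,Du_n+P)=\bar{H}_n(P)$ in $\mathbf{T}^N$ has a viscosity solution $u_n\in\mathrm{Lip}(\mathbf{T}^N)$. The generalized effective Hamiltonian $\bar{H}_\infty:\mathbf{R}^N\to\mathbf{R}$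 of $H$ is the unique function such that for every sequence $\{H_n\}$ satisfying (A1)--(A4) one has $\liminf_{n\to\infty}\inf_{\overline{B(0,R)}}(\bar{H}_\infty-\bar{H}_n)\ge0$ for all $R>0$ and $\limsup_{n\to\infty}\sup_{\mathbf{R}^N}(\bar{H}_\infty-\bar{H}_n)\le0$; in particular $\bar{H}_\infty(P)=\lim_{n\to\infty}\bar{H}_n(P)$ for every $P$ and every such sequence. *)

(* Defs.v *)
From HB Require Import structures.
From mathcomp Require Import all_boot all_order all_algebra.
From mathcomp Require Import all_classical all_reals all_analysis.
Set Implicit Arguments.
Unset Strict Implicit.
Unset Printing Implicit Defensive.
Import Order.TTheory GRing.Theory Num.Theory.
Import numFieldNormedType.Exports.
Local Open Scope classical_set_scope.
Local Open Scope ring_scope.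

(* The Euclidean norm |p| on R^N: the library norm on row vectors is the sup
   norm. Both induce the same topology, derivatives and Lipschitz functions, so
   the library notions are used for those. *)
Definition euclid_norm (R : realType) (N : nat) (p : 'rV[R]_N) : R :=
  Num.sqrt (\sum_(i < N) p 0 i ^+ 2).

(* Functions on the torus T^N are Z^N-periodic functions on R^N; a supremum,
   infimum or extremum over T^N is then the same over all of R^N. *)
Definition Zperiodic (R : realType) (N : nat) (T : Type) (f : 'rV[R]_N -> T) :=
  forall (x : 'rV[R]_N) (k : 'rV[int]_N), f (x + map_mx intr k) = f x.

Definition gradient (R : realType) (N : nat) (phi : 'rV[R]_N -> R)
    (x : 'rV[R]_N) : 'rV[R]_N :=
  \row_(i < N) 'D_(delta_mx 0 i) phi x.

Definition C1_torus (R : realType) (N : nat) : set ('rV[R]_N -> R) :=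
  [set phi | [/\ Zperiodic phi,
                 forall x, differentiable phi x
               & continuous (gradient phi)]].

Definition Lip_torus (R : realType) (N : nat) : set ('rV[R]_N -> R) :=
  [set u | Zperiodic u /\ lipschitz u].

(* D^+ u(x) *)
Definition superdifferential (R : realType) (N : nat) (u : 'rV[R]_N -> R)
    (x : 'rV[R]_N) : set 'rV[R]_N :=
  [set p | exists2 phi, C1_torus phi &
     (forall y, u y - phi y <= u x - phi x) /\ p = gradient phi x].

(* D^- u(x) *)
Definition subdifferential (R : realType) (N : nat) (u : 'rV[R]_N -> R)
    (x : 'rV[R]_N) : set 'rV[R]_N :=
  [set p | exists2 phi, C1_torus phi &
     (forall y, u x - phi x <= u y - phi y) /\ p = gradient phi x].

Definition viscosity_subsolution (R : realType) (N : nat)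
    (F : 'rV[R]_N -> 'rV[R]_N -> R) (u : 'rV[R]_N -> R) :=
  forall x p, superdifferential u x p -> F x p <= 0.

Definition viscosity_supersolution (R : realType) (N : nat)
    (F : 'rV[R]_N -> 'rV[R]_N -> R) (u : 'rV[R]_N -> R) :=
  forall x p, subdifferential u x p -> 0 <= F x p.

Definition viscosity_solution (R : realType) (N : nat)
    (F : 'rV[R]_N -> 'rV[R]_N -> R) (u : 'rV[R]_N -> R) :=
  viscosity_subsolution F u /\ viscosity_supersolution F u.

Definition cell_solution (R : realType) (N : nat)
    (G : 'rV[R]_N -> 'rV[R]_N -> R) (P : 'rV[R]_N)
    (u : 'rV[R]_N -> R) (a : R) :=
  Lip_torus u /\ viscosity_solution (fun x p => G x (p + P) - a) u.

Definition critical_values (R : realType) (N : nat)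
    (G : 'rV[R]_N -> 'rV[R]_N -> R) (P : 'rV[R]_N) : set R :=
  [set a | exists u, cell_solution G P u a].

Definition solvability_set (R : realType) (N : nat)
    (G : 'rV[R]_N -> 'rV[R]_N -> R) : set 'rV[R]_N :=
  [set P | exists u a, cell_solution G P u a].

(* For continuous coercive G there is exactly one critical value at each P, so
   the default value 0 of xget is never used. *)
Definition effective_hamiltonian (R : realType) (N : nat)
    (G : 'rV[R]_N -> 'rV[R]_N -> R) (P : 'rV[R]_N) : R :=
  xget 0 (critical_values G P).

Definition continuous_hamiltonian (R : realType) (N : nat)
    (G : 'rV[R]_N -> 'rV[R]_N -> R) :=
  Zperiodic G /\ continuous (fun z : 'rV[R]_N * 'rV[R]_N => G z.1 z.2).

Definition separable_hamiltonian (R : realType) (N : nat)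
    (sigma : 'rV[R]_N -> R) (m : R -> R) (x p : 'rV[R]_N) : R :=
  sigma x * m (euclid_norm p).

Definition coercive (R : realType) (N : nat)
    (G : 'rV[R]_N -> 'rV[R]_N -> R) :=
  ereal_inf [set (G z.1 z.2)%:E | z in [set z | r <= euclid_norm z.2]]
    @[r --> +oo%R] --> +oo%E.

Definition approximating_sequence (R : realType) (N : nat)
    (H : 'rV[R]_N -> 'rV[R]_N -> R) (Hn : nat -> 'rV[R]_N -> 'rV[R]_N -> R) :=
  [/\ forall n, continuous_hamiltonian (Hn n),
      forall n, coercive (Hn n),
      forall r : R, 0 < r ->
        (0 <= limn_einf (fun n =>
           ereal_inf [set (H z.1 z.2 - Hn n z.1 z.2)%:E |
             z in [set z | (euclid_norm z.2 <= r)%R]]))%E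
    & (limn_esup (fun n =>
           ereal_sup [set (H z.1 z.2 - Hn n z.1 z.2)%:E | z in setT]) <= 0)%E].

Definition is_generalized_effective_hamiltonian (R : realType) (N : nat)
    (H : 'rV[R]_N -> 'rV[R]_N -> R) (Hinf : 'rV[R]_N -> R) :=
  forall Hn : nat -> 'rV[R]_N -> 'rV[R]_N -> R, approximating_sequence H Hn ->
    (forall r : R, 0 < r ->
       (0 <= limn_einf (fun n =>
          ereal_inf [set (Hinf P - effective_hamiltonian (Hn n) P)%:E |
            P in [set P | (euclid_norm P <= r)%R]]))%E) /\
    (limn_esup (fun n =>
       ereal_sup [set (Hinf P - effective_hamiltonian (Hn n) P)%:E |
         P in setT]) <= 0)%E.

(* Main.v *)
(* Replace m by M_n(s) = m(s) + max(0, s - n): the Hamiltonians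
   H_n = sigma M_n(|p|) are coercive and approximate H.  They agree with H for
   |p| <= n, so a Lipschitz solution of the cell problem for H solves the one for
   H_n once n is large, whence a = Hinf P; touching u from below near a minimum
   point of sigma gives a < sigma_min because |Du + P| is bounded and m < 1.
   Conversely, if Hinf P < sigma_min, take n with critical value
   a_n < sigma_min m(n).  A solution (u_n, a_n) for H_n is a subsolution for H as
   H <= H_n, and a supersolution because sigma m(|q|) >= sigma_min m(n) > a_n
   whenever |q| > n, where H and H_n differ.

   Solutions for H_n exist by a weak KAM argument.  Let a be the least level
   admitting a subsolution, and W_y the largest subsolution at level a that
   vanishes at y.  If no W_y were a solution, each W_y could be bumped at y into a
   subsolution strict near y; averaging finitely many of these over a cover of
   the torus would give a subsolution at a level below a.  (If a is the least
   conceivable level max sigma M_n(0), no bump is possible at a maximum point of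
   sigma.) *)
Require Import Defs.
From HB Require Import structures.
From mathcomp Require Import all_boot all_order all_algebra.
From mathcomp Require Import all_classical all_reals all_analysis.
From mathcomp Require Import ring lra.
Import Order.TTheory GRing.Theory Num.Theory.
Import numFieldNormedType.Exports.
Local Open Scope classical_set_scope.
Local Open Scope ring_scope.

Set Implicit Arguments.
Unset Strict Implicit.
Unset Printing Implicit Defensive.

(** * Euclidean inner product and norm, compared with the sup norm *)

Section Euclidean.
Variables (R : realType) (N : nat).
Implicit Types (x y p q : 'rV[R]_N).

Definition dot p q : R := \sum_(i < N) p 0 i * q 0 i.

Lemma dotDl p q x : dot (p + q) x = dot p x + dot q x.
Proof. by rewrite -big_split/=; apply: eq_bigr => i _; rewrite mxE mulrDl. Qed.

Lemma dotC p q : dot p q = dot q p.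
Proof. by apply: eq_bigr => i _; rewrite mulrC. Qed.

Lemma dotDr p q x : dot x (p + q) = dot x p + dot x q.
Proof. by rewrite !(dotC x) dotDl. Qed.

Lemma dotZl a p q : dot (a *: p) q = a * dot p q.
Proof. by rewrite mulr_sumr; apply: eq_bigr => i _; rewrite mxE mulrA. Qed.

Lemma dotZr a p q : dot p (a *: q) = a * dot p q.
Proof. by rewrite !(dotC p) dotZl. Qed.

Lemma dotr0 p : dot p 0 = 0.
Proof. by rewrite -(scale0r p) dotZr mul0r. Qed.

Lemma dotNl p q : dot (- p) q = - dot p q.
Proof. by rewrite -scaleN1r dotZl mulN1r. Qed.

Lemma dotNr p q : dot p (- q) = - dot p q.
Proof. by rewrite !(dotC p) dotNl. Qed.

Lemma dotBr p q x : dot x (p - q) = dot x p - dot x q.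
Proof. by rewrite dotDr dotNr. Qed.

Lemma euclid_norm_ge0 p : 0 <= euclid_norm p.
Proof. exact: sqrtr_ge0. Qed.

Lemma dotpp p : dot p p = euclid_norm p ^+ 2.
Proof.
by rewrite sqr_sqrtr ?sumr_ge0// => i _; exact: sqr_ge0.
Qed.

Lemma dotpp_ge0 p : 0 <= dot p p.
Proof. by rewrite dotpp sqr_ge0. Qed.

Lemma euclid_normE p : euclid_norm p = Num.sqrt (dot p p).
Proof. by []. Qed.

Lemma euclid_normZ a p : euclid_norm (a *: p) = `|a| * euclid_norm p.
Proof.
by rewrite !euclid_normE dotZl dotZr mulrA -expr2 sqrtrM ?sqr_ge0// sqrtr_sqr.
Qed.

Lemma euclid_normN p : euclid_norm (- p) = euclid_norm p.
Proof. by rewrite !euclid_normE dotNl dotNr opprK. Qed.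

Lemma euclid_normB p q : euclid_norm (p - q) = euclid_norm (q - p).
Proof. by rewrite -euclid_normN opprB. Qed.

(** Cauchy-Schwarz, from the nonnegative square of [dot q q *: p - dot p q *: q], which equals
    [dot q q] times the difference of the two sides squared. *)
Lemma le_dot p q : dot p q <= euclid_norm p * euclid_norm q.
Proof.
apply: le_trans (ler_norm _) _.
rewrite -[leRHS]ger0_norm ?mulr_ge0 ?euclid_norm_ge0//.
rewrite -ler_sqr ?nnegrE// !real_normK ?num_real// exprMn -!dotpp.
have [q0|q0] := eqVneq (dot q q) 0.
  have -> : dot p q = 0.
    rewrite /dot big1// => i _.
    move/eqP: q0; rewrite /dot psumr_eq0 => [/allP/(_ i)|j _]; last exact: sqr_ge0.
    by rewrite mem_index_enum mulf_eq0 orbb => /(_ isT)/eqP ->; rewrite mulr0.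
  by rewrite q0 expr0n/= mulr0.
have q1 : 0 < dot q q by rewrite lt_def q0 dotpp_ge0.
have := dotpp_ge0 (dot q q *: p - dot p q *: q).
rewrite dotBr !(dotC (_ - _)) !dotBr !(dotZl, dotZr) (dotC q p) => h.
rewrite -subr_ge0 -(pmulr_rge0 _ q1); apply: le_trans h _.
rewrite le_eqVlt; apply/orP; left; apply/eqP; ring.
Qed.

Lemma le_coord_norm x (i : 'I_N) : `|x 0 i| <= `|x|.
Proof.
rewrite (_ : `|x| = mx_norm x)// mx_normrE.
exact: (le_bigmax _ (fun ij : 'I_1 * 'I_N => `|x ij.1 ij.2|) (0, i)).
Qed.

Lemma le_norm_euclid x : `|x| <= euclid_norm x.
Proof.
rewrite (_ : `|x| = mx_norm x)// mx_normrE; apply/bigmax_leP; split=> [|[i j] _ /=].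
  exact: euclid_norm_ge0.
rewrite -sqrtr_sqr ler_sqrt; last by apply: sumr_ge0 => k _; exact: sqr_ge0.
rewrite (ord1 i) (bigD1 j)//= lerDl.
by apply: sumr_ge0 => k _; exact: sqr_ge0.
Qed.

Lemma euclid_le_norm x : euclid_norm x <= N%:R * `|x|.
Proof.
rewrite -ler_sqr ?nnegrE ?mulr_ge0 ?euclid_norm_ge0 //.
rewrite -dotpp exprMn; apply: (@le_trans _ _ (N%:R * `|x| ^+ 2)).
  have -> : N%:R * `|x| ^+ 2 = \sum_(i < N) `|x| ^+ 2.
    by rewrite sumr_const card_ord mulr_natl.
  apply: ler_sum => i _.
  by rewrite -expr2 -real_normK ?num_real// ler_sqr ?nnegrE// le_coord_norm.
rewrite ler_wpM2r ?sqr_ge0//.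
by rewrite -natrX ler_nat; case: (N) => // n; rewrite expnS expn1 leq_pmulr.
Qed.

Lemma coord_cts (i : 'I_N) : continuous (fun x : 'rV[R]_N => x 0 i).
Proof. exact: coord_continuous. Qed.

Lemma continuous_bigsum (T : topologicalType) (f : 'I_N -> T -> R) :
  (forall i, continuous (f i)) -> continuous (fun t : T => \sum_(i < N) f i t).
Proof.
move=> fc t; rewrite (_ : (fun s => \sum_i f i s) = \sum_i f i); last first.
  by apply/funext => s; rewrite fct_sumE.
elim/big_ind : _ => [|g h gc hc|i _].
- exact: cst_continuous.
- exact: continuousD.
- exact: fc.
Qed.

Lemma continuous_sub (T : topologicalType) (f g : T -> R) :
  continuous f -> continuous g -> continuous (fun t : T => f t - g t).
Proof. by move=> cf cg t; exact: (continuousB (cf t) (cg t)). Qed.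

Lemma continuous_scale (T : topologicalType) (f : T -> R) a :
  continuous f -> continuous (fun t : T => a * f t).
Proof.
by move=> cf t; exact: (continuousM (@cst_continuous _ _ a t) (cf t)).
Qed.

Lemma continuous_comp_fst (T U : topologicalType) (f : T -> R) :
  continuous f -> continuous (fun z : T * U => f z.1).
Proof.
move=> cf z.
by apply: (continuous_comp (f := fst) (g := f)); [exact: cvg_fst|exact: cf].
Qed.

Lemma continuous_comp_snd (T U : topologicalType) (f : U -> R) :
  continuous f -> continuous (fun z : T * U => f z.2).
Proof.
move=> cf z.
by apply: (continuous_comp (f := snd) (g := f)); [exact: cvg_snd|exact: cf].
Qed.

Lemma euclid_norm_continuous : continuous (@euclid_norm R N).
Proof.
move=> x; apply: (continuous_comp (f := fun p => dot p p)); last exact: sqrt_continuous.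
move: x; apply: continuous_bigsum => i x.
by apply: continuousM; exact: coord_cts.
Qed.

End Euclidean.

(** * Derivatives along lines in terms of the gradient *)

Section Gradient.
Variables (R : realType) (N : nat).
Implicit Types (x y v : 'rV[R]_N) (f : 'rV[R]_N -> R).

Lemma derive_gradient f x v : differentiable f x ->
  'D_v f x = dot (gradient f x) v.
Proof.
move=> df; rewrite deriveE// {1}(row_sum_delta v) linear_sum/=.
apply: eq_bigr => i _; rewrite linearZ/= mxE deriveE//.
by rewrite [_ *: _]mulrC.
Qed.

Lemma is_derive_line f x v t : differentiable f (x + t *: v) ->
  is_derive t 1 (fun s : R => f (x + s *: v)) (dot (gradient f (x + t *: v)) v).
Proof.
move=> df.
have dg : is_diff t (fun s : R => x + s *: v) (fun s : R => s *: v).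
  have h := is_diffD (is_diff_cst x t) (is_diff_scalel t v).
  by apply: is_diff_eq; rewrite add0r.
have dl : differentiable (fun s : R => x + s *: v) t by [].
have dfg : differentiable (fun s : R => f (x + s *: v)) t.
  exact: (differentiable_comp dl df).
split; first exact/derivable1_diffP.
rewrite deriveE// (_ : 'd _ t = 'd f (x + t *: v) \o
  'd (fun s : R => x + s *: v) t :> (R -> R)); last first.
  exact: (diff_comp dl df).
by rewrite /= diff_val scale1r -deriveE// derive_gradient.
Qed.

Lemma gradient_MVT f x v : (forall y, differentiable f y) ->
  exists2 t, 0 <= t <= 1 & f (x + v) - f x = dot (gradient f (x + t *: v)) v.
Proof.
move=> df.
have [||c] := @MVT_segment R (fun s : R => f (x + s *: v))
    (fun s : R => dot (gradient f (x + s *: v)) v) 0 1 ler01.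
- by move=> s _; exact: is_derive_line.
- apply: continuous_subspaceT => s.
  have [h _] := is_derive_line (df (x + s *: v)).
  by apply: differentiable_continuous; exact/derivable1_diffP.
rewrite in_itv /= scale1r scale0r addr0 subr0 mulr1 => c01 ->.
by exists c.
Qed.

Lemma gradient_line f x v e : differentiable f x -> 0 < e ->
  exists2 d, 0 < d & forall t, 0 < t < d ->
    `|f (x + t *: v) - f x - t * dot (gradient f x) v| <= e * t.
Proof.
move=> df e0.
have := @is_derive_line f x v 0; rewrite scale0r addr0 => /(_ df)[dg dE].
move/cvgrPdist_le: dg => /(_ _ e0).
rewrite -/(derive _ _ _) dE.
move=> /nbhs_ballP[d /= d0 h]; exists d => // t /andP[t0 td].
have := h t; rewrite /ball/= sub0r normrN gtr0_norm// => /(_ td).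
rewrite gt_eqF// => /(_ isT).
rewrite [_%:A]mulr1 addr0 scale0r addr0 => {}h.
rewrite -(@ler_pM2l _ t^-1) ?invr_gt0//.
rewrite -{1}(@gtr0_norm _ t^-1) ?invr_gt0// -normrM.
rewrite (mulrC e) mulKf ?gt_eqF// mulrBr mulKf ?gt_eqF//.
by rewrite distrC.
Qed.

End Gradient.

(** * Compactness of the torus and a smooth periodic distance *)

Section Torus.
Variables (R : realType) (N : nat).
Implicit Types (x y z : 'rV[R]_N) (k : 'rV[int]_N).

Local Notation "k %:L" := (map_mx intr k : 'rV[R]_N) (at level 2, format "k %:L").

Lemma latticeN k : (- k)%:L = - k%:L.
Proof. by apply/rowP => i; rewrite !mxE intrN. Qed.

Definition unit_cube : set 'rV[R]_N := [set x | forall i, x 0 i \in `[0, 1]].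

Lemma unit_cube_compact : compact unit_cube.
Proof.
apply: (@rV_compact R N (fun=> `[0, 1]%classic)) => _.
exact: segment_compact.
Qed.

Lemma unit_cube0 : unit_cube 0.
Proof. by move=> i; rewrite mxE in_itv/= lexx ler01. Qed.

Lemma translate_unit_cube x : exists k, unit_cube (x + k%:L).
Proof.
exists (\row_i - Num.floor (x 0 i)) => i; rewrite !mxE in_itv/= intrN.
have /andP[h1 h2] := floor_itv (x 0 i); rewrite intrD1 in h2.
by apply/andP; split; lra.
Qed.

(** Compactness of the torus is used through this reduction to a compact fundamental domain. *)
Lemma periodic_unit_cube (Q : 'rV[R]_N -> Prop) :
  (forall x k, Q (x + k%:L) -> Q x) -> (forall x, unit_cube x -> Q x) ->
  forall x, Q x.
Proof. by move=> Qp Qc x; have [k /Qc /Qp] := translate_unit_cube x. Qed.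

Lemma compact_lower_bound (T : topologicalType) (K : set T) (f : T -> R) :
  compact K -> continuous f -> (forall t, K t -> 0 < f t) ->
  exists2 c, 0 < c & forall t, K t -> c <= f t.
Proof.
move=> cK cf f0; have [K0|/set0P/negP/negPn/eqP K0] := pselect (K !=set0); last first.
  by exists 1 => // t; rewrite K0.
have [c cK' h] := compact_EVT_min K0 cK (continuous_subspaceT cf).
by exists (f c) => [|t Kt]; [apply: f0; rewrite inE in cK'|apply: h; rewrite inE].
Qed.

Lemma torus_max (f : 'rV[R]_N -> R) : Zperiodic f -> continuous f ->
  exists x, forall y, f y <= f x.
Proof.
move=> pf cf; have K0 : unit_cube !=set0 by exists 0; exact: unit_cube0.
have [c _ h] := compact_EVT_max K0 unit_cube_compact (continuous_subspaceT cf).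
exists c; apply: periodic_unit_cube => [x k|x xK]; first by rewrite pf.
by apply: h; rewrite inE.
Qed.

Lemma torus2_max (f : 'rV[R]_N * 'rV[R]_N -> R) :
  (forall x y k, f (x + k%:L, y) = f (x, y)) ->
  (forall x y k, f (x, y + k%:L) = f (x, y)) -> continuous f ->
  exists c, forall x y, f (x, y) <= f c.
Proof.
move=> pf1 pf2 cf.
have K0 : unit_cube `*` unit_cube !=set0.
  by exists (0, 0); split; exact: unit_cube0.
have [c _ h] := compact_EVT_max K0
  (compact_setX unit_cube_compact unit_cube_compact) (continuous_subspaceT cf).
exists c => x y; move: x; apply: periodic_unit_cube => [x k|x xK].
  by rewrite pf1.
move: y; apply: periodic_unit_cube => [y k|y yK]; first by rewrite pf2.
by apply: h; rewrite inE.
Qed.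

(* A periodic C^1 substitute for the squared distance on the torus. *)
Definition cosd x y : R := \sum_(i < N) (1 - cos (2 * pi * (x 0 i - y 0 i))).

Lemma cosd_term_ge0 (t : R) : 0 <= 1 - cos t.
Proof. by rewrite subr_ge0 cos_le1. Qed.

Lemma cosd_ge0 x y : 0 <= cosd x y.
Proof. by apply: sumr_ge0 => i _; exact: cosd_term_ge0. Qed.

Lemma cosdxx x : cosd x x = 0.
Proof. by rewrite /cosd big1// => i _; rewrite subrr mulr0 cos0 subrr. Qed.

Lemma cosdC x y : cosd x y = cosd y x.
Proof. by apply: eq_bigr => i _; rewrite -cosN -mulrN opprB. Qed.

Lemma cos2piDint (t : R) (n : int) : cos (2 * pi * (t + n%:~R)) = cos (2 * pi * t).
Proof.
have nat_case (s : R) (j : nat) : cos (2 * pi * (s + j%:R)) = cos (2 * pi * s).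
  rewrite mulrDr (_ : 2 * pi * j%:R = (pi *+ 2) *+ j); first last.
    by rewrite -[RHS]mulr_natr mulr2n; ring.
  by rewrite periodicn//; exact: cosD2pi.
case: n => j; first by rewrite -pmulrn nat_case.
by rewrite NegzE intrN -{2}(subrK j.+1%:~R t) -!pmulrn nat_case.
Qed.

Lemma cosdDl x y k : cosd (x + k%:L) y = cosd x y.
Proof. by apply: eq_bigr => i _; rewrite !mxE addrAC cos2piDint. Qed.

Lemma cosdDr x y k : cosd x (y + k%:L) = cosd x y.
Proof. by rewrite cosdC cosdDl cosdC. Qed.

(** Subtracting the floor leaves [s] in [0, 1) with cosine 1 at [2 * pi * s]. The double angle
    formula gives [sin (pi * s) = 0], while the sine is positive on (0, pi), so [s = 0]. *)
Lemma cos2pi_eq1 (t : R) : cos (2 * pi * t) = 1 -> exists n : int, t = n%:~R.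
Proof.
move=> ct; exists (Num.floor t).
have /andP[h1 h2] := floor_itv t; rewrite intrD1 in h2.
have := cos2piDint t (- Num.floor t); rewrite ct intrN.
set s := t - _ => cs.
have s01 : 0 <= s < 1 by rewrite /s; apply/andP; split; lra.
suff : s = 0 by rewrite /s; lra.
apply/eqP; case/andP: s01; rewrite le_eqVlt => /orP[/eqP <-//|s0 s1].
have sp : 0 < sin (pi * s).
  by apply: sin_gt0_pi; rewrite mulr_gt0 ?pi_gt0//= gtr_pMr ?pi_gt0.
move: cs; rewrite -mulrA mulr_natl cos_mulr2n => cs.
have := sin2cos2 (pi * s); have := sp; nra.
Qed.

Lemma cosd_eq0 x y : cosd x y = 0 -> exists k, x = y + k%:L.
Proof.
move=> /eqP; rewrite psumr_eq0 => [/allP h|i _]; last exact: cosd_term_ge0.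
have {}h i : exists n : int, x 0 i - y 0 i = n%:~R.
  apply: cos2pi_eq1; have := h i; rewrite mem_index_enum => /(_ isT)/=.
  by rewrite subr_eq0 => /eqP.
have [g hg] := choice h.
by exists (\row_i g i); apply/rowP => i; rewrite !mxE -hg addrC subrK.
Qed.

Lemma cosd_gt0 x y : (forall k, x <> y + k%:L) -> 0 < cosd x y.
Proof.
move=> h; rewrite lt_def cosd_ge0 andbT; apply/eqP => /cosd_eq0[k]; exact: h.
Qed.

Lemma cosd_continuous2 : continuous (fun z : 'rV[R]_N * 'rV[R]_N => cosd z.1 z.2).
Proof.
apply: continuous_bigsum => i z; apply: continuousB; first exact: cst_continuous.
apply: (continuous_comp
  (f := fun z : 'rV[R]_N * 'rV[R]_N => 2 * pi * (z.1 0 i - z.2 0 i))).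
  apply: continuousM; first exact: cst_continuous.
  apply: continuousB.
    apply: (continuous_comp (f := fst) (g := fun x : 'rV[R]_N => x 0 i));
      first exact: cvg_fst.
    exact: coord_cts.
  apply: (continuous_comp (f := snd) (g := fun x : 'rV[R]_N => x 0 i));
    first exact: cvg_snd.
  exact: coord_cts.
exact: continuous_cos.
Qed.

Lemma is_diff_coord y (i : 'I_N) :
  is_diff y (fun z => z 0 i) (fun v => v 0 i).
Proof.
have lin : linear (fun v : 'rV[R]_N => v 0 i : R).
  by move=> a u v; rewrite !mxE.
pose lM := GRing.isLinear.Build _ _ _ _ _ lin.
pose L : {linear _ -> _} := HB.pack (fun v : 'rV[R]_N => v 0 i : R) lM.
have LE : (fun v : 'rV[R]_N => v 0 i : R) = L by [].
have cL : continuous L by exact: coord_continuous.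
rewrite LE; apply: DiffDef; first exact/linear_differentiable.
by rewrite diff_lin.
Qed.

Lemma is_diff_cosd_term x y (i : 'I_N) :
  is_diff y (fun z => 1 - cos (2 * pi * (x 0 i - z 0 i)))
   (fun v => - (2 * pi * sin (2 * pi * (x 0 i - y 0 i))) * v 0 i).
Proof.
pose h (t : R) : R := 1 - cos (2 * pi * (x 0 i - t)).
have hd (t : R) : is_derive t 1 h (- (2 * pi * sin (2 * pi * (x 0 i - t)))).
  have d1 : is_derive t 1 (fun s : R => 2 * pi * (x 0 i - s)) (- (2 * pi)).
    rewrite (_ : (fun _ => _) = (2 * pi) \*: (cst (x 0 i) - id)) //.
    by apply: is_derive_eq; rewrite sub0r [_ *: _]mulrN1.
  rewrite (_ : h = cst 1 - (cos \o fun s : R => 2 * pi * (x 0 i - s))) //.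
  by apply: is_derive_eq; rewrite sub0r /GRing.scale/=; ring.
have dh : is_diff (y 0 i) h
    (fun s => - (2 * pi * sin (2 * pi * (x 0 i - y 0 i))) * s).
  have [d1 d2] := hd (y 0 i).
  apply: DiffDef; first exact/derivable1_diffP.
  rewrite diff1E; last exact/derivable1_diffP.
  by apply/funext => s; rewrite derive1E d2 [LHS]mulrC.
exact: is_diff_comp (is_diff_coord y i) dh.
Qed.
Lemma differentiable_cosd x y : differentiable (cosd x) y.
Proof.
rewrite (_ : cosd x = \sum_i fun y => 1 - cos (2 * pi * (x 0 i - y 0 i))).
  by apply: differentiable_sum => i; have := is_diff_cosd_term x y i => -[].
by apply/funext => z; rewrite fct_sumE.
Qed.

Lemma gradient_cosd x y :
  gradient (cosd x) y = \row_i - (2 * pi * sin (2 * pi * (x 0 i - y 0 i))).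
Proof.
apply/rowP => j; rewrite !mxE.
rewrite (_ : cosd x = \sum_i fun y => 1 - cos (2 * pi * (x 0 i - y 0 i))); last first.
  by apply/funext => z; rewrite fct_sumE.
have ht i := is_diff_cosd_term x y i.
rewrite derive_sum => [|i]; last by apply: diff_derivable; have [] := ht i.
rewrite (bigD1 j)//= big1 ?addr0 => [|i ij].
  have [d1 d2] := ht j.
  by rewrite deriveE// d2 mxE !eqxx mulr1.
have [d1 d2] := ht i.
by rewrite deriveE// d2 mxE (negbTE ij) andbF mulr0.
Qed.

(** Because of this antisymmetry, a penalty [j * cosd] offers the same covector to both functions
    when variables are doubled. *)
Lemma gradient_cosdC x y : gradient (cosd x) y = - gradient (cosd y) x.
Proof.
rewrite !gradient_cosd; apply/rowP => i; rewrite !mxE.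
by rewrite -(opprB (x 0 i)) mulrN sinN mulrN !opprK.
Qed.

Lemma row_continuous (T : topologicalType) (f : 'I_N -> T -> R) :
  (forall i, continuous (f i)) -> continuous (fun t : T => \row_i f i t).
Proof.
move=> fc t; apply/cvg_ballP => e e0.
have : \forall s \near t, forall i, ball (f i t) e (f i s).
  apply: filter_forall => i; have /cvg_ballP := fc i t; exact.
apply: filterS => s h; split=> // j i; rewrite !mxE; exact: h.
Qed.

Lemma gradient_cosd_continuous x : continuous (gradient (cosd x)).
Proof.
rewrite (_ : gradient (cosd x) =
  fun y => \row_i - (2 * pi * sin (2 * pi * (x 0 i - y 0 i)))); last first.
  by apply/funext => y; rewrite gradient_cosd.
apply: row_continuous => i y.
apply: (@continuousN _ _ _ (fun z => 2 * pi * sin (2 * pi * (x 0 i - z 0 i)))).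
apply: continuousM.
  exact: cst_continuous.
apply: (continuous_comp (f := fun z : 'rV[R]_N => 2 * pi * (x 0 i - z 0 i))).
  apply: continuousM; first exact: cst_continuous.
  by apply: continuousB; [exact: cst_continuous|exact: coord_cts].
exact: continuous_sin.
Qed.
Lemma C1_cosd x : C1_torus (cosd x).
Proof.
split; [by move=> y k; exact: cosdDr|exact: differentiable_cosd|].
exact: gradient_cosd_continuous.
Qed.

Lemma cosd_continuous x : continuous (cosd x).
Proof. by move=> y; exact: differentiable_continuous (differentiable_cosd x y). Qed.

(** Outside the periodic hull [W] of a neighbourhood of [x], [cosd x] is positive; on the compact
    part of the cube left there it has a positive lower bound, below which [Q] must hold. *)
Lemma cosd_nbhs (Q : 'rV[R]_N -> Prop) x :
  (forall z k, Q z -> Q (z + k%:L)) -> (\forall z \near x, Q z) ->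
  exists2 e, 0 < e & forall z, cosd x z < e -> Q z.
Proof.
move=> Qp Qx; have [V [Vo Vx VQ]] : exists V : set 'rV[R]_N,
    [/\ open V, V x & forall z, V z -> Q z].
  exists [set z | Q z]°; split; [exact: open_interior|exact: Qx|].
  by move=> z; exact: interior_subset.
have {}Qp z k : Q (z + k%:L) <-> Q z.
  split; last exact: Qp.
  by move=> /(Qp _ (- k)); rewrite latticeN addrK.
pose W := [set z | exists k, V (z + k%:L)].
have Wo : open W.
  rewrite (_ : W = \bigcup_k ((fun z => z + k%:L) @^-1` V)); last first.
    by apply/seteqP; split=> z [k]; [exists k|exists k].
  apply: bigcup_open => k _; apply: open_comp => // z _.
  by apply: continuousD => //; exact: cst_continuous.
have cK : compact (unit_cube `&` ~` W).
  by apply: compact_closedI; [exact: unit_cube_compact|exact: open_closedC].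
have [|c c0 hc] := compact_lower_bound cK (@cosd_continuous x).
  move=> z [_ Wz]; apply: cosd_gt0 => k xz; apply: Wz; exists k.
  by rewrite -xz.
exists c => // z; move: z; apply: periodic_unit_cube => [z k|z zK].
  by rewrite cosdDr Qp.
move=> zc; apply: contrapT => nQ; move: zc; rewrite ltNge => /negP; apply.
by apply: hc; split=> // -[k /VQ]; rewrite Qp.
Qed.

End Torus.

(** * Calculus of test functions and bounds on semidifferentials *)

Section Semidifferentials.
Variables (R : realType) (N : nat).
Implicit Types (x y z p v : 'rV[R]_N) (f g u phi : 'rV[R]_N -> R).

Lemma euclid_normD p v : euclid_norm (p + v) <= euclid_norm p + euclid_norm v.
Proof.
have [->|h] := eqVneq (euclid_norm (p + v)) 0.
  by rewrite addr_ge0 ?euclid_norm_ge0.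
have h0 : 0 < euclid_norm (p + v) by rewrite lt_def h euclid_norm_ge0.
rewrite -(ler_pM2r h0) -expr2 -dotpp {1}dotDl mulrDl.
by apply: lerD; exact: le_dot.
Qed.

Section LinearCombination.
Variables (f g : 'rV[R]_N -> R) (a c : R).

Lemma differentiable_lin x : differentiable f x -> differentiable g x ->
  differentiable (fun z => f z + a * g z + c) x.
Proof.
move=> df dg.
exact: (differentiableD (differentiableD df (differentiableZ a dg))
  (differentiable_cst c x)).
Qed.

Lemma gradient_lin x : differentiable f x -> differentiable g x ->
  gradient (fun z => f z + a * g z + c) x = gradient f x + a *: gradient g x.
Proof.
move=> df dg; apply/rowP => i; rewrite !mxE.
pose e : 'rV[R]_N := delta_mx 0 i.
have df' : is_derive x e f ('D_e f x) by split=> //; exact: diff_derivable.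
have dg' : is_derive x e g ('D_e g x) by split=> //; exact: diff_derivable.
have [_ h] := is_deriveD (is_deriveD df' (is_deriveZ a dg'))
  (is_derive_cst c x e).
by apply: etrans h _; rewrite addr0.
Qed.

Lemma C1_lin : C1_torus f -> C1_torus g ->
  C1_torus (fun z => f z + a * g z + c).
Proof.
move=> [pf df cf] [pg dg cg]; split=> [x k|x|].
- by rewrite pf pg.
- exact: differentiable_lin.
- rewrite (_ : gradient _ = gradient f + a \*: gradient g).
    move=> x; apply: continuousD; first exact: cf.
    by apply: continuousZr; exact: cg.
  by apply/funext => x; rewrite gradient_lin.
Qed.

End LinearCombination.

Lemma gradient0 x : gradient (fun=> 0) x = 0 :> 'rV[R]_N.
Proof. by apply/rowP => i; rewrite !mxE (derive_cst (0 : R)). Qed.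

Lemma C1_0 : @C1_torus R N (fun=> 0).
Proof.
split=> [//|x|]; first exact: differentiable_cst.
rewrite (_ : gradient _ = cst 0); first exact: cst_continuous.
by apply/funext => x; rewrite gradient0.
Qed.

Lemma C1_scale g a : C1_torus g -> C1_torus (fun z => a * g z).
Proof.
move=> /(C1_lin a 0 C1_0); congr C1_torus.
by apply/funext => z; rewrite add0r addr0.
Qed.

Lemma gradient_scale g a x : differentiable g x ->
  gradient (fun z => a * g z) x = a *: gradient g x.
Proof.
move=> dg; rewrite -[RHS]add0r -(gradient0 x) -(gradient_lin a 0)//.
by congr gradient; apply/funext => z; rewrite add0r addr0.
Qed.

(** Transfers bounds on superdifferentials to subdifferentials. *)
Lemma superdifferentialN u x p :
  superdifferential (fun z => - u z) x (- p) <-> subdifferential u x p.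
Proof.
split=> -[phi C1 [h hp]].
- exists (fun z => -1 * phi z); first exact: C1_scale.
  split=> [y|]; first by have := h y; lra.
  by have [_ d _] := C1; rewrite gradient_scale// -hp scaleN1r opprK.
- exists (fun z => -1 * phi z); first exact: C1_scale.
  split=> [y|]; first by have := h y; lra.
  by have [_ d _] := C1; rewrite gradient_scale// -hp scaleN1r.
Qed.

(** At a maximum of [u - phi] the increments of [u] are at most those of [phi], so a growth rate [c]
    of [u] along [v] bounds the directional derivative of [phi] from below. *)
Lemma superdifferential_dir u x p v (c d : R) : 0 < d ->
  superdifferential u x p ->
  (forall t, 0 < t < d -> c * t <= u (x + t *: v) - u x) -> c <= dot p v.
Proof.
move=> d0 [phi [_ dphi _] [hmax ->]] hu.
apply/ler_addgt0Pr => e e0.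
have [d' d'0 h] := gradient_line v (dphi x) e0.
pose t := Num.min d d' / 2.
have m0 : 0 < Num.min d d' by rewrite lt_min d0.
have t0 : 0 < t by rewrite /t divr_gt0.
have tm : t < Num.min d d' by rewrite /t; lra.
move: (tm); rewrite lt_min => /andP[td td'].
have := h t; rewrite t0 td' => /(_ isT).
have := hu t; rewrite t0 td => /(_ isT).
have := hmax (x + t *: v).
rewrite ler_norml => h1 h2 /andP[_ h3].
rewrite -(ler_pM2r t0); set D := dot _ _ in h3 *.
by rewrite mulrDl (mulrC D); lra.
Qed.

(** The direction [- p] gives [- (L * |p|) <= - |p|^2]. *)
Lemma superdifferential_bound u x p L : 0 <= L ->
  (forall y z, `|u y - u z| <= L * euclid_norm (y - z)) ->
  superdifferential u x p -> euclid_norm p <= L.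
Proof.
move=> L0 lip sup.
have := @superdifferential_dir u x p (- p) (- (L * euclid_norm p)) 1 ltr01 sup.
have hl t : 0 < t < 1 ->
    - (L * euclid_norm p) * t <= u (x + t *: - p) - u x.
  move=> /andP[t0 _]; have := lip (x + t *: - p) x.
  rewrite (addrAC x) subrr add0r euclid_normZ euclid_normN (gtr0_norm t0).
  by rewrite ler_norml mulNr -mulrA (mulrC t) => /andP[].
move=> /(_ hl); rewrite dotNr dotpp lerN2 expr2.
have [->//|p0] := eqVneq (euclid_norm p) 0.
by rewrite ler_pM2r// lt_def p0 euclid_norm_ge0.
Qed.

Lemma subdifferential_bound u x p L : 0 <= L ->
  (forall y z, `|u y - u z| <= L * euclid_norm (y - z)) ->
  subdifferential u x p -> euclid_norm p <= L.
Proof.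
move=> L0 lip /superdifferentialN /superdifferential_bound.
rewrite euclid_normN; apply => // y z.
by rewrite -opprD normrN.
Qed.

Lemma lipschitz_euclid u : lipschitz u ->
  exists2 L, 0 <= L &
    forall y z, `|u y - u z| <= L * euclid_norm (y - z).
Proof.
move=> lu; have [L [L0 h]] : exists L, 0 <= L /\
    forall y z, `|u y - u z| <= L * `|y - z|.
  have : \forall L \near +oo, 0 <= L /\ forall y z, `|u y - u z| <= L * `|y - z|.
    near=> L; split; first by near: L; exact: nbhs_pinfty_ge.
    move=> y z; suff : L.-lipschitz u by move/(_ (y, z)); apply.
    by near: L.
  by move/filter_ex.
exists L => // y z; apply: le_trans (h y z) _.
by rewrite ler_wpM2l// le_norm_euclid.
Unshelve. all: by end_near. Qed.

Lemma euclid_lipschitz u L : 0 <= L ->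
  (forall y z, `|u y - u z| <= L * euclid_norm (y - z)) -> lipschitz u.
Proof.
move=> L0 h; have F : ProperFilter
    (globally ([set: 'rV[R]_N] `*` [set: 'rV[R]_N])).
  exact: (@globally_properfilter _ _ (0, 0)).
apply: (@klipschitzW _ _ _ (L * N%:R)) => -[y z] _ /=.
apply: le_trans (h y z) _.
by rewrite -mulrA ler_wpM2l// euclid_le_norm.
Qed.

Lemma euclid_lipschitz_continuous u L : 0 <= L ->
  (forall y z, `|u y - u z| <= L * euclid_norm (y - z)) -> continuous u.
Proof.
move=> L0 h x; apply/(@cvgrPdist_lt _ _ _ _ (nbhs_filter x)) => e e0.
have d0 : 0 < L * N%:R + 1 by rewrite ltr_wpDl// mulr_ge0.
apply/nbhs_ballP; exists (e / (L * N%:R + 1)) => [|y]; first exact: divr_gt0.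
rewrite -ball_normE /= ltr_pdivlMr// mulrC => hy.
apply: le_lt_trans hy; apply: le_trans (h x y) _.
rewrite mulrDl mul1r ler_wpDr// -mulrA ler_wpM2l//.
exact: euclid_le_norm.
Qed.

End Semidifferentials.

(** * Comparison of sub- and supersolutions by doubling of variables *)

Section Comparison.
Variables (R : realType) (N : nat).
Implicit Types (x y z p P : 'rV[R]_N) (u v : 'rV[R]_N -> R).
Variables (sigma : 'rV[R]_N -> R) (M : R -> R).
Hypothesis sigma_periodic : Zperiodic sigma.
Hypothesis sigma_continuous : continuous sigma.
Hypothesis sigma_gt0 : forall x, 0 < sigma x.
Hypothesis M_gt0 : forall s, 0 <= s -> 0 < M s.

(** On the diagonal of the torus the inequality would read [b <= a]; compactness turns this
    exclusion into a uniform gap. *)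
Lemma cosd_separated (a b : R) : a < b -> 0 < a ->
  exists2 c, 0 < c & forall x y, b * sigma x <= a * sigma y -> c <= cosd x y.
Proof.
move=> ab a0.
pose K := (@unit_cube R N `*` @unit_cube R N) `&`
  [set z | b * sigma z.1 - a * sigma z.2 <= 0].
have cf : continuous (fun z : 'rV[R]_N * 'rV[R]_N => b * sigma z.1 - a * sigma z.2).
  by apply: continuous_sub; apply: continuous_scale;
    [exact: continuous_comp_fst|exact: continuous_comp_snd].
have cK : compact K.
  apply: compact_closedI.
    by apply: compact_setX; exact: unit_cube_compact.
  apply: (@closed_comp _ _
    (fun z : 'rV[R]_N * 'rV[R]_N => b * sigma z.1 - a * sigma z.2)
    [set r | r <= 0]) => [z _|]; [exact: cf|exact: closed_le].
have [[x y] [_ /= h]|c c0 hc] := compact_lower_bound cK (@cosd_continuous2 R N).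
  apply: cosd_gt0 => k xy; move: h; rewrite xy sigma_periodic -mulrBl.
  by rewrite pmulr_lle0 ?sigma_gt0// subr_le0 leNgt ab.
exists c => // x y h.
have [k xk] := translate_unit_cube x; have [l yl] := translate_unit_cube y.
rewrite -(cosdDl x y k) -(cosdDr (x + _) y l).
by apply: (hc (_, _)); split; rewrite //= !sigma_periodic subr_le0.
Qed.

(** At a maximum of [u x - v y - j * cosd x y] both functions share one covector, so
    [sigma x * M q <= a] and [b <= sigma y * M q]. If [a < b], multiplying these yields
    [b * sigma x <= a * sigma y], which separates [x] from [y]. The product form of the Hamiltonian
    makes one large [j] enough, with no limit. *)
Lemma visc_comparison P u v a b :
  Zperiodic u -> continuous u -> Zperiodic v -> continuous v ->
  viscosity_subsolution
    (fun x p => separable_hamiltonian sigma M x (p + P) - a) u ->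
  viscosity_supersolution
    (fun x p => separable_hamiltonian sigma M x (p + P) - b) v ->
  b <= a.
Proof.
move=> pu cu pv cv subu supv; rewrite leNgt; apply/negP => ab.
have [xu hu] := torus_max pu cu.
have [yv hv] : exists y, forall z, - v z <= - v y.
  by apply: torus_max => [x k|x]; [rewrite pv|apply: continuousN; exact: cv].
pose C := u xu - v yv - (u 0 - v 0).
have C0 : 0 <= C by rewrite /C; have := hu 0; have := hv 0; lra.
(* Touching [u] by a constant at its maximum shows that [a] is at least a positive value of the
   Hamiltonian. *)
have [a0|a0] := leP a 0.
  have : superdifferential u xu 0.
    exists (fun=> 0); first exact: C1_0.
    by split=> [y|]; [have := hu y; lra|rewrite gradient0].
  move=> /subu; rewrite /separable_hamiltonian.
  have : 0 < sigma xu * M (euclid_norm (0 + P)).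
    by rewrite mulr_gt0 ?M_gt0 ?euclid_norm_ge0.
  lra.
have [c c0 hc] := cosd_separated ab a0.
(* With this weight, separated points pay at least [C + 1], whereas [u x - v y] exceeds its value at
   the origin by at most [C]. *)
pose j := (C + 1) / c.
have j0 : 0 <= j by rewrite divr_ge0 ?ltW//; lra.
have jc : j * c = C + 1 by rewrite divfK ?gt_eqF.
pose Phi (z : 'rV[R]_N * 'rV[R]_N) := u z.1 - v z.2 - j * cosd z.1 z.2.
have [|||[x y] hmax] := @torus2_max R N Phi.
- by move=> x y k; rewrite /Phi/= pu cosdDl.
- by move=> x y k; rewrite /Phi/= pv cosdDr.
- apply: continuous_sub; last exact/continuous_scale/cosd_continuous2.
  by apply: continuous_sub;
    [exact: continuous_comp_fst|exact: continuous_comp_snd].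
rewrite /Phi/= in hmax.
have Du : superdifferential u x (j *: gradient (cosd y) x).
  exists (fun z => j * cosd y z); first exact/C1_scale/C1_cosd.
  split; last by rewrite gradient_scale//; exact: differentiable_cosd.
  by move=> z; have := hmax z y; rewrite !(cosdC y); lra.
have Dv : subdifferential v y (j *: gradient (cosd y) x).
  exists (fun z => - j * cosd x z); first exact/C1_scale/C1_cosd.
  split; first by move=> z; have := hmax x z; lra.
  rewrite gradient_scale; last exact: differentiable_cosd.
  by rewrite gradient_cosdC scalerN scaleNr.
have := subu _ _ Du; have := supv _ _ Dv; rewrite /separable_hamiltonian.
set q := euclid_norm _ => h1 h2.
have q0 : 0 < M q by apply: M_gt0; exact: euclid_norm_ge0.
have := hc x y; have -> : b * sigma x <= a * sigma y.
  rewrite -(ler_pM2r q0).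
  apply: (@le_trans _ _ (a * b)).
    by rewrite -mulrA mulrC ler_wpM2r//; lra.
  by rewrite -mulrA ler_wpM2l//; lra.
move=> /(_ isT) cxy; have := hmax 0 0; rewrite cosdxx mulr0 subr0.
have := ler_wpM2l j0 cxy; rewrite jc.
by have := hu x; have := hv y; rewrite /C; lra.
Qed.

End Comparison.

(** * Subsolutions in metric form *)

Section MetricSubsolutions.
Variables (R : realType) (N : nat).
Implicit Types (x y z p : 'rV[R]_N) (u v : 'rV[R]_N -> R) (a b s t : R).
Variables (sigma : 'rV[R]_N -> R) (M : R -> R) (P xm xM : 'rV[R]_N).
Hypothesis sigma_periodic : Zperiodic sigma.
Hypothesis sigma_continuous : continuous sigma.
Hypothesis sigma_gt0 : forall x, 0 < sigma x.
Hypothesis sigma_ge : forall x, sigma xm <= sigma x.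
Hypothesis sigma_le : forall x, sigma x <= sigma xM.
Hypothesis M_gt0 : forall s, 0 <= s -> 0 < M s.
Hypothesis M_lt : forall r s, 0 <= r -> r < s -> M r < M s.
Variable L : R.
Hypothesis L_gt0 : 0 < L.
Hypothesis M_lipschitz : forall r s, 0 <= r -> r <= s -> M s - M r <= L * (s - r).
Hypothesis M_unbounded : forall A, exists2 s, 0 <= s & A <= M s.

(** Expresses [M^-1 (a / sigma) <= s] along the segment without inverting [M], so that it also makes
    sense where [a / sigma] is below [M 0]. *)
Definition admissible_slope a x y s :=
  0 <= s /\ forall t, 0 <= t <= 1 -> a <= sigma (x + t *: (y - x)) * M s.

(* The Lipschitz form of [sigma x * M |Dv + P| <= a]: along any segment where
   [M^-1 (a / sigma) <= s], the function [v + P . x] is [s]-Lipschitz. *)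
Definition metric_subsolution a v := Zperiodic v /\
  forall x y s, admissible_slope a x y s ->
    v y - v x + dot P (y - x) <= s * euclid_norm (y - x).

(* Below this level the constraint [sigma x * M |p| <= a] is empty at [xM]. *)
Definition least_level : R := sigma xM * M 0.

Lemma M_le r s : 0 <= r -> r <= s -> M r <= M s.
Proof.
by move=> r0; rewrite le_eqVlt => /orP[/eqP ->//|/M_lt h]; rewrite ltW// h.
Qed.

Lemma admissible_slopeW a b x y s : a <= b ->
  admissible_slope b x y s -> admissible_slope a x y s.
Proof. by move=> ab [s0 h]; split=> // t /h; exact: le_trans. Qed.

Lemma metric_subsolutionW a b v : a <= b ->
  metric_subsolution a v -> metric_subsolution b v.
Proof. by move=> ab [pv h]; split=> // x y s /(admissible_slopeW ab)/h. Qed.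

Lemma uniform_slope a : exists2 s, 0 <= s &
  forall x y, admissible_slope a x y s.
Proof.
have [s s0 h] := M_unbounded (a / sigma xm); exists s => // x y.
split=> // t _; apply: (@le_trans _ _ (sigma xm * M s)).
  by rewrite mulrC -ler_pdivrMr.
by rewrite ler_pM2r// M_gt0.
Qed.

(** The constant [s + |P|] depends only on the level, through a slope admissible on all segments;
    this keeps suprema and infima of families of subsolutions finite. *)
Lemma metric_subsolution_lipschitz a : exists2 L, 0 <= L &
  forall v, metric_subsolution a v ->
  forall y z, `|v y - v z| <= L * euclid_norm (y - z).
Proof.
have [s s0 h] := uniform_slope a; exists (s + euclid_norm P).
  by rewrite addr_ge0// euclid_norm_ge0.
move=> v [_ hv] y z; rewrite ler_norml.
have h1 := hv _ _ _ (h y z); have h2 := hv _ _ _ (h z y).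
have := le_dot P (y - z); have := le_dot P (z - y).
rewrite (euclid_normB z y) in h1 *; rewrite mulrDl.
have e : dot P (z - y) = - dot P (y - z) by rewrite -dotNr opprB.
by rewrite e in h1 *; lra.
Qed.

(** If [sigma x * M |q| > a] with [q = p + P] nonzero, a slope [s < |q|] is still admissible on
    short segments ending at [x]. Going from [x] in direction [- q] then gives [|q|^2 <= s * |q|], a
    contradiction. The case [q = 0] is excluded by [least_level <= a]. *)
Lemma metric_subsolution_visc a v : least_level <= a ->
  metric_subsolution a v -> viscosity_subsolution
    (fun x p => separable_hamiltonian sigma M x (p + P) - a) v.
Proof.
move=> la [pv hv] x p sup; rewrite subr_le0 /separable_hamiltonian leNgt.
apply/negP; set q := p + P => ha.
have [q0|qn0] := eqVneq (euclid_norm q) 0.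
  move: ha; rewrite q0 ltNge => /negP; apply; apply: le_trans la.
  by rewrite /least_level ler_pM2r ?M_gt0.
have q0 : 0 < euclid_norm q by rewrite lt_def qn0 euclid_norm_ge0.
have [s [s0 sq hs]] : exists s, [/\ 0 <= s, s < euclid_norm q & a < sigma x * M s].
  pose g := sigma x * M (euclid_norm q) - a.
  have g0 : 0 < g by rewrite subr_gt0.
  (* Lowering [|q|] by [dl] costs at most [g / 2] in the Hamiltonian at [x], half of its excess over
     [a]. *)
  pose dl := Num.min (euclid_norm q) (g / (2 * (sigma x * L))).
  have c0 : 0 < sigma x * L by rewrite mulr_gt0.
  have dl0 : 0 < dl by rewrite lt_min q0 divr_gt0// mulr_gt0.
  have dlq : dl <= euclid_norm q by rewrite ge_min lexx.
  have dlg : dl * (sigma x * L) <= g / 2.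
    have : dl <= g / (2 * (sigma x * L)) by rewrite ge_min lexx orbT.
    by rewrite invfM mulrA ler_pdivlMr.
  exists (euclid_norm q - dl); split; [by rewrite subr_ge0|by rewrite gtrBl|].
  have h : M (euclid_norm q) - M (euclid_norm q - dl) <= L * dl.
    rewrite -[dl in leRHS](subKr (euclid_norm q)).
    by apply: M_lipschitz; [rewrite subr_ge0|rewrite gerBl ltW].
  have := ler_wpM2l (ltW (sigma_gt0 x)) h.
  by rewrite mulrBr /g in dlg g0 *; lra.
have [d d0 hd] : exists2 d, 0 < d & forall z, `|z - x| < d -> a < sigma z * M s.
  have Ms := M_gt0 s0.
  have : \forall z \near x, a / M s < sigma z.
    apply: (@cvgr_gt _ _ (nbhs x) _ sigma (sigma x) (sigma_continuous (x:=x))).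
    by rewrite ltr_pdivrMr.
  move=> /nbhs_ballP[d /= d0 h]; exists d => // z zx.
  by rewrite -ltr_pdivrMr//; apply: h; rewrite -ball_normE/= distrC.
have := @superdifferential_dir _ _ v x p (- q)
  (dot P q - s * euclid_norm q) (d / euclid_norm q) (divr_gt0 d0 q0) sup.
have hq t : 0 < t < d / euclid_norm q ->
    (dot P q - s * euclid_norm q) * t <= v (x + t *: - q) - v x.
  move=> /andP[t0 td]; rewrite ltr_pdivlMr// in td.
  have adm : admissible_slope a (x + t *: - q) x s.
    split=> // r /andP[r0 r1]; apply/ltW/hd.
    have -> : x + t *: - q + r *: (x - (x + t *: - q)) - x = (r * t - t) *: q.
      by apply/rowP => i; rewrite !mxE; ring.
    rewrite normrZ; apply: le_lt_trans td.
    rewrite ler_pM ?normr_ge0// ?le_norm_euclid//.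
    have rt : r * t <= t by rewrite ger_pMl.
    have rt0 : 0 <= r * t by rewrite mulr_ge0// ltW.
    by rewrite ler_norml; apply/andP; split; lra.
  have := hv _ _ _ adm.
  have -> : x - (x + t *: - q) = t *: q.
    by apply/rowP => i; rewrite !mxE; ring.
  by rewrite dotZr euclid_normZ gtr0_norm//; lra.
move=> /(_ hq); rewrite dotNr => h.
have : dot q q <= s * euclid_norm q by rewrite {1}/q dotDl; lra.
by rewrite dotpp expr2 ler_pM2r// leNgt sq.
Qed.

(** Cut the segment into [n] equal pieces shorter than [d]; a slope admissible on the whole segment
    is admissible on each piece, and the inequalities telescope. *)
Lemma metric_subsolution_local a v d : 0 < d ->
  (forall x y, `|y - x| < d -> forall s, admissible_slope a x y s ->
    v y - v x + dot P (y - x) <= s * euclid_norm (y - x)) ->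
  forall x y s, admissible_slope a x y s ->
    v y - v x + dot P (y - x) <= s * euclid_norm (y - x).
Proof.
move=> d0 h x y s [s0 hs].
pose n := (Num.truncn (`|y - x| / d)).+1.
have n0 : 0 < n%:R :> R by rewrite ltr0n.
have nd : `|y - x| / n%:R < d.
  by rewrite ltr_pdivrMr// -ltr_pdivrMl// mulrC truncnS_gt.
pose z (i : nat) := x + (i%:R / n%:R) *: (y - x).
have zS i : z i.+1 - z i = n%:R^-1 *: (y - x).
  rewrite /z opprD addrACA subrr add0r -scalerBl -mulrBl -natrB// subSnn.
  by rewrite mul1r.
have hz i : (i <= n)%N ->
    v (z i) - v x + dot P (z i - x) <= s * (i%:R / n%:R * euclid_norm (y - x)).
  elim: i => [_|i IH iln].
    by rewrite /z mul0r scale0r addr0 !subrr dotr0 !mul0r mulr0 addr0.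
  have {}IH := IH (ltnW iln).
  have adm : admissible_slope a (z i) (z i.+1) s.
    split=> // t /andP[t0 t1]; rewrite zS /z scalerA -addrA -scalerDl.
    apply: hs; rewrite -mulrDl; apply/andP; split.
      by rewrite divr_ge0 ?ler0n ?addr_ge0.
    rewrite ler_pdivrMr// mul1r.
    have : i.+1%:R <= n%:R :> R by rewrite ler_nat.
    by rewrite -natr1; lra.
  have := h (z i) (z i.+1) _ s adm; rewrite zS normrZ euclid_normZ dotZr.
  have n1 : 0 <= n%:R^-1 :> R by rewrite invr_ge0 ltW.
  rewrite !(ger0_norm n1) mulrC => /(_ nd).
  have -> : z i.+1 - x = (z i.+1 - z i) + (z i - x) by rewrite addrA subrK.
  rewrite zS (dotDr (n%:R^-1 *: _)) dotZr -natr1; move: IH.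
  set e := euclid_norm _; set D := dot P (z i - x); set D' := dot P _.
  by move=> IH h1; rewrite mulrDl mulrDl mul1r; lra.
have := hz n (leqnn n); rewrite divff ?gt_eqF// mul1r.
by rewrite /z divff ?gt_eqF// scale1r (addrC x) subrK.
Qed.

(** At level [sigma xM * M |P|] every admissible slope is at least [|P|], so Cauchy-Schwarz suffices
    for a constant function. *)
Lemma metric_subsolution_exists :
  exists2 a, least_level <= a & metric_subsolution a (fun=> 0).
Proof.
exists (Num.max least_level (sigma xM * M (euclid_norm P))).
  by rewrite le_max lexx.
split=> // x y s [s0 h]; rewrite subrr add0r.
apply: le_trans (le_dot _ _) _; rewrite ler_wpM2r ?euclid_norm_ge0//.
rewrite leNgt; apply/negP => /(M_lt s0) lt.
have := h 0; rewrite lexx ler01 => /(_ isT).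
rewrite leNgt => /negP; apply; rewrite lt_max; apply/orP; right.
apply: (@le_lt_trans _ _ (sigma xM * M s)).
  by rewrite ler_pM2r ?M_gt0.
by rewrite ltr_pM2l.
Qed.

(** * Maximal subsolutions and the critical level *)

Lemma metric_subsolution_shift a v c : metric_subsolution a v ->
  metric_subsolution a (fun x => v x + c).
Proof.
move=> [pv h]; split=> [x k|x y s]; first by rewrite pv.
by move=> /h; lra.
Qed.

(** The intrinsic semidistance from [y], or Mañé potential, of weak KAM theory. The supremum is
    meaningful as soon as the level admits a subsolution. *)
Definition max_metric_subsolution a y x : R :=
  sup [set v x | v in [set v | metric_subsolution a v /\ v y = 0]].

Lemma max_metric_subsolution_has_sup a v y x : metric_subsolution a v ->
  has_sup [set v x | v in [set v | metric_subsolution a v /\ v y = 0]].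
Proof.
move=> hv; split.
  exists (v x - v y); exists (fun z => v z - v y) => //.
  by split; [exact: metric_subsolution_shift|rewrite subrr].
have [C C0 h] := metric_subsolution_lipschitz a.
exists (C * euclid_norm (x - y)) => _ [u [/h hu uy] <-].
by have := hu x y; rewrite uy subr0; exact: le_trans (ler_norm _).
Qed.

Lemma max_metric_subsolutionP a v y : metric_subsolution a v ->
  [/\ metric_subsolution a (max_metric_subsolution a y),
      max_metric_subsolution a y y = 0 &
      forall u x, metric_subsolution a u -> u y = 0 ->
        u x <= max_metric_subsolution a y x].
Proof.
move=> hv; have hs x := max_metric_subsolution_has_sup y x hv.
have ub u x : metric_subsolution a u -> u y = 0 ->
    u x <= max_metric_subsolution a y x.
  by move=> hu uy; apply: sup_upper_bound => //; exists u.
split=> //; last first.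
  apply/eqP; rewrite eq_le; apply/andP; split.
    by apply: ge_sup; [case: (hs y)|move=> _ [u [_ uy] <-]; rewrite uy].
  have := ub (fun z => v z - v y) y; rewrite subrr; apply => //.
  exact: metric_subsolution_shift.
split=> [x k|x z s adm].
  congr sup; apply/seteqP; split=> _ [u [hu uy] <-]; exists u => //.
    by case: hu => pu _; rewrite pu.
  by case: hu => pu _; rewrite pu.
rewrite -lerBrDr lerBlDr; apply: ge_sup; first by case: (hs z).
move=> _ [u [hu uy] <-]; have := ub u x hu uy.
by case: hu => _ /(_ _ _ _ adm); lra.
Qed.

(** The infimum of the levels is attained: the maximal subsolutions [W a] vanishing at 0 increase
    with [a], so their pointwise infimum acts as the limit at the least level. *)
Lemma critical_level : exists2 a, least_level <= a &
  (exists v, metric_subsolution a v) /\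
  forall b v, least_level <= b -> metric_subsolution b v -> a <= b.
Proof.
pose A := [set a | least_level <= a /\ exists v, metric_subsolution a v].
have [a1 la1 ha1] := metric_subsolution_exists.
have Aa1 : A a1 by split=> //; exists (fun=> 0).
have hA : has_inf A by split; [exists a1|exists least_level => a []].
exists (inf A); first by apply: lb_le_inf; [exists a1|move=> a []].
split; last by move=> b v lb hv; apply: ge_inf; [case: hA|split=> //; exists v].
pose W a x := max_metric_subsolution a 0 x.
have WP a : A a -> [/\ metric_subsolution a (W a), W a 0 = 0 &
    forall u x, metric_subsolution a u -> u 0 = 0 -> u x <= W a x].
  by move=> [_ [v /max_metric_subsolutionP]]; exact.
have Wmono a b x : A a -> A b -> a <= b -> W a x <= W b x.
  move=> /WP[h0 h1 _] /WP[_ _ h2] ab; apply: h2 => //.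
  exact: metric_subsolutionW ab h0.
(* Capping the levels gives all [W a] a common Lipschitz constant, hence finite infima. *)
pose B := [set a | A a /\ a <= a1].
have [C C0 hC] := metric_subsolution_lipschitz a1.
have lbW x a : B a -> - (C * euclid_norm x) <= W a x.
  move=> [/WP[h0 h1 _] ha]; have := hC _ (metric_subsolutionW ha h0) x 0.
  by rewrite h1 !subr0 ler_norml => /andP[].
have hB x : has_inf [set W a x | a in B].
  split; first by exists (W a1 x), a1.
  by exists (- (C * euclid_norm x)) => _ [a Ba <-]; exact: lbW.
have leW x a : B a -> inf [set W a x | a in B] <= W a x.
  by move=> Ba; apply: ge_inf; [case: (hB x)|exists a].
exists (fun x => inf [set W a x | a in B]); split=> [x k|x y s [s0 hs]].
  congr inf; apply/seteqP.
  by split=> _ [a Ba <-]; exists a => //; case: Ba => /WP[[-> ]].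
apply/ler_addgt0Pr => e e0.
have ne := euclid_norm_ge0 (y - x).
pose d := e / (euclid_norm (y - x) + 1).
have d0 : 0 < d by rewrite divr_gt0// ltr_wpDl.
have de : d * euclid_norm (y - x) <= e.
  rewrite /d mulrAC ler_pdivrMr; last by rewrite ltr_wpDl.
  by rewrite ler_wpM2l ?lerDl// ltW.
suff : inf [set W a y | a in B] + dot P (y - x) - (s + d) * euclid_norm (y - x)
    <= inf [set W a x | a in B] by rewrite mulrDl; lra.
apply: lb_le_inf; first by case: (hB x).
move=> _ [a Ba <-].
(* By strict monotonicity, if [s] is admissible at level [inf A], then [s + d] is admissible up to
   level [inf A + g], where true levels [b] exist. The excess slope [d] costs at most [e]. *)
pose g := sigma xm * (M (s + d) - M s).
have g0 : 0 < g by rewrite mulr_gt0// subr_gt0 M_lt// ltrDl.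
have [b Ab bg] := inf_adherent g0 hA.
have Bm : B (Num.min a b).
  have [Aa aa1] := Ba; split; last by rewrite ge_min aa1.
  by rewrite /Num.min; case: ifP.
have adm : admissible_slope (Num.min a b) x y (s + d).
  split=> [|t ht]; first by rewrite addr_ge0// ltW.
  have := hs _ ht; have : g <= sigma (x + t *: (y - x)) * (M (s + d) - M s).
    by rewrite ler_wpM2r// subr_ge0 M_le// lerDl ltW.
  have : Num.min a b <= b by rewrite ge_min lexx orbT.
  by rewrite mulrBr; lra.
have /WP[[_ /(_ _ _ _ adm) h] _ _] : A (Num.min a b) by case: Bm.
have := leW y _ Bm.
have : W (Num.min a b) x <= W a x.
  by apply: Wmono; [case: Bm|case: Ba|rewrite ge_min lexx].
by lra.
Qed.

(** * Local strictness, bumps and averaging *)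

Lemma translateB (V : zmodType) (x y k : V) : (y + k) - (x + k) = y - x.
Proof. by rewrite opprD addrACA subrr addr0. Qed.

(** It expresses strictness when [a] is taken below the level at which [v] is a subsolution on the
    whole torus. *)
Definition strict_at a v d x := forall y, `|y - x| < d ->
  forall s, admissible_slope a x y s ->
    v y - v x + dot P (y - x) <= s * euclid_norm (y - x).

Lemma admissible_slopeDl a x y (k : 'rV[int]_N) s :
  admissible_slope a (x + map_mx intr k) (y + map_mx intr k) s <->
  admissible_slope a x y s.
Proof.
have e t : sigma (x + map_mx intr k + t *: (y + map_mx intr k - (x + map_mx intr k)))
    = sigma (x + t *: (y - x)).
  by rewrite translateB addrAC sigma_periodic.
by split=> -[s0 h]; split=> // t /h; rewrite e.
Qed.

Lemma strict_atDl a v d x (k : 'rV[int]_N) : Zperiodic v ->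
  strict_at a v d x <-> strict_at a v d (x + map_mx intr k).
Proof.
move=> pv; split=> h y yx s adm.
  have yE : y = y - map_mx intr k + map_mx intr k by rewrite subrK.
  have e : y - (x + map_mx intr k) = y - map_mx intr k - x.
    by rewrite opprD addrA addrAC.
  rewrite e pv; rewrite yE admissible_slopeDl in adm.
  rewrite e in yx; have := h _ yx _ adm.
  by rewrite -(pv (y - _) k) subrK.
have e : (y + map_mx intr k) - (x + map_mx intr k) = y - x.
  exact: translateB.
rewrite -e -(pv x k) -(pv y k); apply: h; first by rewrite e.
exact/admissible_slopeDl.
Qed.

Lemma gradient_cosdxx x : gradient (cosd x) x = 0.
Proof.
by rewrite gradient_cosd; apply/rowP => i; rewrite !mxE subrr mulr0 sin0 mulr0 oppr0.
Qed.

Lemma segment_dist x y z t r : 0 <= t <= 1 -> `|x - z| < r -> `|y - x| < r ->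
  `|x + t *: (y - x) - z| < r + r.
Proof.
move=> /andP[t0 t1] xz yx; rewrite addrAC.
apply: le_lt_trans (ler_normD _ _) _; apply: ltrD => //.
rewrite normrZ ger0_norm//; apply: le_lt_trans yx.
by rewrite ler_piMl.
Qed.

(** [M] is controlled only on nonnegative reals; the absolute value gives a function continuous on
    the whole line. *)
Lemma M_normr_continuous : continuous (fun r : R => M `|r|).
Proof.
have lip r s : 0 <= r -> 0 <= s -> `|M r - M s| <= L * `|r - s|.
  wlog rs : r s / r <= s.
    move=> h r0 s0; have [|/ltW] := leP r s => rs; first exact: h.
    by rewrite distrC (distrC r); exact: h.
  move=> r0 s0; rewrite distrC ger0_norm ?subr_ge0 ?M_le//.
  by rewrite distrC ger0_norm ?subr_ge0// M_lipschitz.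
move=> r; apply/cvgrPdist_lt => e e0.
apply/nbhs_ballP; exists (e / L) => [|s]; first exact: divr_gt0.
rewrite /ball/= ltr_pdivlMr// mulrC; apply: le_lt_trans.
apply: le_trans (lip _ _ _ _) _; rewrite ?normr_ge0//.
by rewrite ler_pM2l// ler_dist_dist.
Qed.

Lemma hamiltonian_gradient_continuous (G : 'rV[R]_N -> 'rV[R]_N) :
  continuous G ->
  continuous (fun z => sigma z * M (euclid_norm (G z + P))).
Proof.
move=> cG; rewrite (_ : (fun z => _) =
    (fun z => sigma z * M `|euclid_norm (G z + P)|)); last first.
  by apply/funext => z; rewrite ger0_norm ?euclid_norm_ge0.
move=> z; apply: (continuousM (sigma_continuous (x := z))).
apply: (continuous_comp (f := fun z => euclid_norm (G z + P))
  (g := fun r => M `|r|)); last exact: M_normr_continuous.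
apply: (continuous_comp (f := fun z => G z + P) (g := @euclid_norm R N)).
  by apply: continuousD; [exact: cG|exact: cst_continuous].
exact: euclid_norm_continuous.
Qed.

(* Where [v] fails to be a supersolution it can be pushed above its touching
   test function; this keeps it a subsolution, which becomes strict near [x0]. *)
Lemma bump a v x0 phi (e1 : R) : metric_subsolution a v ->
  C1_torus phi -> (forall y, v x0 - phi x0 <= v y - phi y) ->
  sigma x0 * M (euclid_norm (gradient phi x0 + P)) < a -> 0 < e1 ->
  exists v' a' d, [/\ metric_subsolution a v', v x0 < v' x0,
    forall x, e1 <= cosd x0 x -> v' x = v x, a' < a &
    0 < d /\ forall x, `|x - x0| < d -> strict_at a' v' d x].
Proof.
move=> hv C1phi touch lt_a e10.
(* Subtracting [cosd x0] makes the contact strict modulo the lattice: [v - psi0 >= cosd x0], with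
   equality at [x0]. *)
pose psi0 (z : 'rV[R]_N) := phi z + -1 * cosd x0 z + (v x0 - phi x0).
have C1psi0 : C1_torus psi0 := C1_lin (-1) (v x0 - phi x0) C1phi (C1_cosd x0).
have [a' lo hi] : exists2 a',
    sigma x0 * M (euclid_norm (gradient phi x0 + P)) < a' & a' < a.
  exists ((sigma x0 * M (euclid_norm (gradient phi x0 + P)) + a) / 2); lra.
have [ppsi dpsi cpsi] := C1psi0.
have gx0 : gradient psi0 x0 = gradient phi x0.
  have [_ dphi _] := C1phi.
  rewrite gradient_lin//; last exact: differentiable_cosd.
  by rewrite gradient_cosdxx scaler0 addr0.
pose good z := sigma z * M (euclid_norm (gradient psi0 z + P)) < a'.
have [r r0 hr] : exists2 r, 0 < r & forall z, `|z - x0| < r + r -> good z.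
  have : \forall z \near x0, good z.
    apply: (@cvgr_lt _ _ (nbhs x0) _ _ _ (hamiltonian_gradient_continuous cpsi (x := x0))).
    by rewrite gx0.
  move=> /nbhs_ballP[r /= r0 h]; exists (r / 2) => [|z hz]; first by lra.
  by apply: h; rewrite -ball_normE/= distrC; lra.
(* [psi0] is periodic, so [x] and [y] may be moved by the same lattice vector. *)
have psi_sub x y k : `|y + map_mx intr k - x0| < r -> `|y - x| < r ->
    forall s, admissible_slope a' x y s ->
    psi0 y - psi0 x + dot P (y - x) <= s * euclid_norm (y - x).
  move=> yx0 yx s [s0 adm].
  have [t t01] := gradient_MVT (x + map_mx intr k) (y - x) dpsi.
  have -> : x + map_mx intr k + (y - x) = y + map_mx intr k.
    by rewrite addrAC (addrC x) subrK.
  rewrite !ppsi => ->.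
  rewrite -dotDl; apply: le_trans (le_dot _ _) _.
  rewrite ler_wpM2r ?euclid_norm_ge0//.
  have gz : good (x + map_mx intr k + t *: (y - x)).
    apply: hr; have -> : x + map_mx intr k + t *: (y - x) =
        y + map_mx intr k + (1 - t) *: (x - y).
      by apply/rowP => i; rewrite !mxE; ring.
    have -> : x - y = x + map_mx intr k - (y + map_mx intr k).
      by rewrite translateB.
    apply: segment_dist => //; first by case/andP: t01 => *; apply/andP; split; lra.
    by rewrite translateB distrC.
  rewrite leNgt; apply/negP => /(M_lt s0) lt.
  have := adm _ t01; rewrite leNgt => /negP; apply.
  have sE : sigma (x + map_mx intr k + t *: (y - x)) = sigma (x + t *: (y - x)).
    by rewrite addrAC sigma_periodic.
  move: gz; rewrite /good sE; apply: le_lt_trans.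
  exact: (ler_wpM2l (ltW (sigma_gt0 _)) (ltW lt)).
have [eta eta0 heta] : exists2 e, 0 < e & forall z, cosd x0 z < e ->
    exists k, `|z + map_mx intr k - x0| < r.
  apply: cosd_nbhs.
    move=> z k [l hl]; exists (l - k).
    have -> : z + map_mx intr k + map_mx intr (l - k) = z + map_mx intr l.
      by apply/rowP => i; rewrite !mxE intrB; ring.
    exact: hl.
  apply/nbhs_ballP; exists r => // z; rewrite -ball_normE/= distrC => hz.
  by exists 0; rewrite map_mx0 addr0.
(* Being below [eta], [e] confines the raised region to within [r] of lattice translates of [x0];
   being below [e1], it leaves [v] unchanged where [cosd x0] is at least [e1]. *)
pose e := Num.min eta e1 / 2.
have m0 : 0 < Num.min eta e1 by rewrite lt_min eta0.
have e0 : 0 < e by rewrite divr_gt0.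
have em : e < Num.min eta e1 by rewrite /e; lra.
pose v' z := Num.max (v z) (psi0 z + e).
have v'E z : Num.min eta e1 <= cosd x0 z -> v' z = v z.
  move=> hz; rewrite /v' max_l// /psi0; have := touch z; lra.
have vge z : v z <= v' z by rewrite le_max lexx.
have pge z : psi0 z + e <= v' z by rewrite le_max lexx orbT.
have psi0x0 : psi0 x0 = v x0 by rewrite /psi0 cosdxx; lra.
have [Lv Lv0 hLv] := metric_subsolution_lipschitz a.
have cv := euclid_lipschitz_continuous Lv0 (hLv _ hv).
have [d d0 hd] : exists2 d, 0 < d & forall z, `|z - x0| < d + d -> v' z = psi0 z + e.
  have : \forall z \near x0, v z - psi0 z < e.
    have cdiff : continuous (fun z => v z - psi0 z).
      by apply: continuous_sub => // z; exact: differentiable_continuous.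
    by apply: (@cvgr_lt _ _ (nbhs x0) _ _ _ (cdiff x0)); rewrite psi0x0 subrr.
  move=> /nbhs_ballP[d /= d0 h]; exists (d / 2) => [|z hz]; first by lra.
  rewrite /v' max_r//; have : v z - psi0 z < e; last by lra.
  by apply: h; rewrite -ball_normE/= distrC; lra.
have [pv hv2] := hv.
exists v', a', (Num.min d (r / 2)); split=> //.
- split.
    by move=> x k; rewrite /v' pv ppsi.
  (* Only the function attaining the maximum at [y] matters, since [v' x] dominates both candidates
     at [x]. *)
  apply: (metric_subsolution_local r0) => x y yx s adm.
  have [yv|yv] := leP (psi0 y + e) (v y).
    rewrite {1}/v' max_l//; apply: le_trans (hv2 _ _ _ adm).
    by have := vge x; lra.
  have yE : v' y = psi0 y + e by rewrite /v' max_r// ltW.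
  have [|k hk] := heta y.
    rewrite ltNge; apply/negP => hy.
    have : Num.min eta e1 <= cosd x0 y by rewrite ge_min hy.
    by move/v'E; rewrite yE; lra.
  have := psi_sub _ _ _ hk yx _ (admissible_slopeW (ltW hi) adm).
  by have := pge x; rewrite yE; lra.
- by have := pge x0; rewrite psi0x0; lra.
- by move=> x hx; apply: v'E; rewrite ge_min hx orbT.
- split; first by rewrite lt_min d0 divr_gt0.
  move=> x; rewrite lt_min => /andP[xd xr] y; rewrite lt_min => /andP[yd yr] s adm.
  have yx0 : `|y - x0| <= `|y - x| + `|x - x0| by exact: ler_distD.
  rewrite (hd x) ?(hd y); [|lra|lra].
  have := @psi_sub x y 0 _ _ s adm; rewrite map_mx0 addr0.
  have h1 : `|y - x0| < r by lra.
  have h2 : `|y - x| < r by lra.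
  by move=> /(_ h1 h2); lra.
Qed.

Definition strict_on a (A : set 'rV[R]_N) := exists v b d,
  [/\ metric_subsolution a v, b < a, 0 < d &
      forall x, A x -> strict_at b v d x].

Lemma strict_onW a A B : A `<=` B -> strict_on a B -> strict_on a A.
Proof.
by move=> AB [v [b [d [? ? ? h]]]]; exists v, b, d; split=> // x /AB/h.
Qed.

(** Strict monotonicity made uniform over bounded slopes, by compactness. *)
Lemma M_increment (g S : R) : 0 < g -> exists2 w, 0 < w &
  forall s, 0 <= s <= S -> w <= M (s + g) - M s.
Proof.
move=> g0; pose f s := M `|s + g| - M `|s|.
have cf : continuous f.
  apply: continuous_sub; last exact: M_normr_continuous.
  move=> s; apply: (continuous_comp (f := fun s : R => s + g) (g := fun s => M `|s|)).
    by apply: continuousD => //; exact: cst_continuous.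
  exact: M_normr_continuous.
have [|w w0 h] := compact_lower_bound (@segment_compact _ 0 S) cf.
  move=> s /=; rewrite in_itv/= => /andP[s0 _].
  rewrite /f !ger0_norm ?addr_ge0 ?(ltW g0)// subr_gt0 M_lt//.
  by rewrite ltrDl.
exists w => // s sS; have /andP[s0 _] := sS.
have := h s; rewrite /= in_itv/= => /(_ sS).
by rewrite /f !ger0_norm ?addr_ge0 ?(ltW g0).
Qed.

(* Averaging costs an increase of the slope where only one of the two functions
   is strict; choosing the new level close enough to [a] makes it negligible. *)
Lemma strict_onU a A B : least_level < a ->
  strict_on a A -> strict_on a B -> strict_on a (A `|` B).
Proof.
move=> la [v1 [a1 [d1 [[p1 h1] a1a d10 s1]]]] [v2 [a2 [d2 [[p2 h2] a2a d20 s2]]]].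
pose b := Num.max least_level (Num.max a1 a2).
have ba : b < a by rewrite !gt_max la a1a.
have b1 : a1 <= b by rewrite !le_max lexx orbT.
have b2 : a2 <= b by rewrite !le_max lexx !orbT.
have b0 : least_level <= b by rewrite le_max lexx.
pose K := sigma xM * L; have K0 : 0 < K by rewrite mulr_gt0.
(* Lowering a slope by [g] lowers [sigma * M] by at most [K * g], half of the gap between the
   levels. *)
pose g := (a - b) / 2 / K.
have g0 : 0 < g by rewrite !divr_gt0// subr_gt0.
have gK : g * K = (a - b) / 2 by rewrite divfK ?gt_eqF.
have [S S0 hS] := uniform_slope a.
have [w w0 hw] := M_increment S g0.
(* A slope [s <= S] admissible at level [a'] has [s + g] admissible at level [a] and [s - g] at
   level [b]; averaging the strict and the other function gives back [s]. *)
pose a' := Num.max ((a + b) / 2) (a - sigma xm * w).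
have a'a : a' < a.
  by rewrite gt_max; apply/andP; split; [lra|rewrite gtrBl mulr_gt0].
have a'1 : (a + b) / 2 <= a' by rewrite le_max lexx.
have a'2 : a - sigma xm * w <= a' by rewrite le_max lexx orbT.
exists (fun z => (v1 z + v2 z) / 2), a', (Num.min d1 d2).
split=> //; last 2 first.
- by rewrite lt_min d10.
- move=> x ABx y; rewrite lt_min => /andP[yd1 yd2] s adm.
  (* [S] is admissible on every segment, so a larger slope follows from the inequality for [S]. *)
  wlog sS : s adm / s <= S.
    move=> h; have [sS|/ltW sS] := leP s S; first exact: h.
    apply: le_trans (h S _ (lexx S)) _.
      exact: admissible_slopeW (ltW a'a) (hS x y).
    by rewrite ler_wpM2r// euclid_norm_ge0.
  have [s0 hs] := adm.
  have up : admissible_slope a x y (s + g).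
    split=> [|t ht]; first by rewrite addr_ge0// ltW.
    have := hs _ ht; have s0S : 0 <= s <= S by rewrite s0.
    have : sigma xm * w <= sigma (x + t *: (y - x)) * (M (s + g) - M s).
      by apply: ler_pM; [exact: ltW|exact: ltW|exact: sigma_ge|exact: hw].
    by rewrite mulrBr; lra.
  have lipK z r r' : 0 <= r -> r <= r' ->
      sigma z * M r' - sigma z * M r <= K * (r' - r).
    move=> r0 rr; rewrite -mulrBr /K -mulrA; apply: ler_pM.
    - exact: ltW.
    - by rewrite subr_ge0 M_le.
    - exact: sigma_le.
    - exact: M_lipschitz.
  (* As [a'] exceeds [least_level] by at least [g * K], an admissible slope cannot be closer than
     [g] to 0. *)
  have gs : g <= s.
    have := hs 0; rewrite lexx ler01 scale0r addr0 => /(_ isT) hx.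
    have := lipK x 0 s (lexx 0) s0; rewrite subr0 => hx2.
    have : sigma x * M 0 <= least_level by rewrite ler_pM2r// M_gt0.
    move=> hx3; rewrite -(ler_pM2r K0) gK (mulrC s); lra.
  have down : admissible_slope b x y (s - g).
    split=> [|t ht]; first by rewrite subr_ge0.
    have := hs _ ht; have := lipK (x + t *: (y - x)) (s - g) s.
    rewrite subr_ge0 gerBl (ltW g0) => /(_ gs isT).
    by rewrite subKr (mulrC K) gK; lra.
  have := euclid_norm_ge0 (y - x); set n := euclid_norm _ => n0.
  case: ABx => [Ax|Bx].
    have := s1 x Ax y yd1 _ (admissible_slopeW b1 down).
    by have := h2 _ _ _ up; rewrite -/n mulrBl mulrDl; lra.
  have := s2 x Bx y yd2 _ (admissible_slopeW b2 down).
  by have := h1 _ _ _ up; rewrite -/n mulrBl mulrDl; lra.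
- split=> [x k|x y s adm]; first by rewrite p1 p2.
  by have := h1 _ _ _ adm; have := h2 _ _ _ adm; lra.
Qed.

(** Compactness by filters: the sets whose complement in the cube is good form a filter, thanks to
    [strict_onU]. If the cube were not good, this filter would be proper, and a cluster point would
    contradict local strictness there. *)
Lemma strict_on_unit_cube a v : least_level < a -> metric_subsolution a v ->
  (forall x, exists2 d, 0 < d & strict_on a (ball x d)) ->
  strict_on a (@unit_cube R N).
Proof.
move=> la hv hloc; apply: contrapT => nstrict.
pose F := [set A | strict_on a (@unit_cube R N `\` A)].
have s0 : strict_on a set0.
  by exists v, (a - 1), 1; split=> //; lra.
have FF : ProperFilter F.
  split; first by rewrite /F/= setD0.
  split.
  - by rewrite /F/= setDT.
  - by move=> A B hA hB; rewrite /F/= setDIr; exact: strict_onU.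
  - by move=> A B AB; apply: strict_onW; exact: setDS.
have [|x [_ cl]] := @unit_cube_compact R N F FF.
  by rewrite /F/= setDv.
have [d d0 hd] := hloc x.
have [|z []//] := cl (~` ball x d) (ball x d) _ (nbhsx_ballx x d d0).
by rewrite /F/= setDE setCK; apply: strict_onW hd; exact: subIsetr.
Qed.

Lemma cell_solution_exists :
  exists u a, cell_solution (separable_hamiltonian sigma M) P u a.
Proof.
have [a la [[v hv] amin]] := critical_level.
pose W := max_metric_subsolution a.
have WP y : [/\ metric_subsolution a (W y), W y y = 0 &
    forall u x, metric_subsolution a u -> u y = 0 -> u x <= W y x].
  exact: max_metric_subsolutionP hv.
have [[y supW]|nosup] := pselect (exists y, viscosity_supersolution
    (fun x p => separable_hamiltonian sigma M x (p + P) - a) (W y)).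
  have [hW _ _] := WP y; exists (W y), a; split; last first.
    by split=> //; exact: metric_subsolution_visc.
  have [C C0 hC] := metric_subsolution_lipschitz a.
  by split; [case: hW|exact: euclid_lipschitz C0 (hC _ hW)].
(* [W y] can fail to be a supersolution only on the lattice orbit of [y]: elsewhere a bump of size
   [cosd x y] would keep the value 0 at [y] and exceed the maximal [W y]. *)
have key y : exists k phi, [/\ C1_torus phi,
    forall z, W y (y + map_mx intr k) - phi (y + map_mx intr k) <= W y z - phi z
    & sigma (y + map_mx intr k) *
      M (euclid_norm (gradient phi (y + map_mx intr k) + P)) < a].
  have [hW Wy0 Wmax] := WP y.
  apply: contrapT => nkey; apply: nosup; exists y => x p [phi C1phi [touch pE]].
  rewrite leNgt subr_lt0; apply/negP => lt_a.
  have cxy : 0 < cosd x y.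
    rewrite cosdC; apply: cosd_gt0 => k yx; apply: nkey; exists (- k), phi.
    have -> : y + map_mx intr (- k) = x by rewrite latticeN yx addrK.
    by rewrite -pE; split.
  rewrite pE in lt_a.
  have [v' [_ [_ [hv' gtx eqy _ _]]]] := bump hW C1phi touch lt_a cxy.
  have := Wmax v' x hv'; rewrite eqy // => /(_ Wy0).
  by rewrite leNgt gtx.
(* At [xM] the Hamiltonian is never below [least_level], so the failure of [W xM] rules out
   equality. *)
have {la} la : least_level < a.
  rewrite lt_def la andbT; apply/eqP => ale.
  have [k [phi [_ _]]] := key xM; rewrite ale sigma_periodic ltr_pM2l//.
  by rewrite ltNge M_le// euclid_norm_ge0.
have [u [b [d [[pu hu] ba d0 hs]]]] : strict_on a (@unit_cube R N).
  apply: (strict_on_unit_cube la hv) => y.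
  have [k [phi [C1phi touch lt_a]]] := key y; have [hW _ _] := WP y.
  have [v' [b [d [hv' _ _ ba [d0 hs]]]]] := bump hW C1phi touch lt_a ltr01.
  exists d => //; exists v', b, d; split=> // z.
  rewrite -ball_normE/= => yz; have [pv' _] := hv'.
  apply/(strict_atDl _ _ _ k pv'); apply: hs.
  by rewrite translateB distrC.
(* Strictness on the cube extends by periodicity and then from short to all segments, giving a level
   below [a]; the maximum with [least_level] keeps it among the levels over which [a] is minimal. *)
have sub_u : metric_subsolution (Num.max least_level b) u.
  apply: (@metric_subsolutionW b); first by rewrite le_max lexx orbT.
  split=> //; apply: (metric_subsolution_local d0).
  suff h x : strict_at b u d x by move=> x y /h; apply.
  move: x; apply: periodic_unit_cube => // x k.
  by move=> h; apply/(strict_atDl _ _ _ k pu).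
have := amin _ _ _ sub_u; rewrite le_max lexx => /(_ isT).
by rewrite leNgt gt_max la ba.
Qed.

End MetricSubsolutions.

(** * Uniqueness of critical values and the coercive approximations *)

Section EffectiveHamiltonian.
Variable R : realType.

Lemma limn_esup_le0 (u : (\bar R)^nat) :
  (\forall n \near \oo, (u n <= 0)%E) -> (limn_esup u <= 0)%E.
Proof.
move=> h; apply: ge_ereal_inf; exists (ereal_sup (u @` [set n | (u n <= 0)%E])).
  by exists [set n | (u n <= 0)%E].
by apply: ge_ereal_sup => _ [n ? <-].
Qed.

Lemma limn_esup_lt (u : (\bar R)^nat) (e : R) : (limn_esup u <= 0)%E -> 0 < e ->
  \forall n \near \oo, (u n < e%:E)%E.
Proof.
move=> h e0; have /ereal_inf_lt[_ [V VF <-] hV] : (limn_esup u < e%:E)%E.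
  by apply: le_lt_trans h _; rewrite lte_fin.
apply: filterS VF => n Vn; apply: le_lt_trans hV.
by apply: ereal_sup_ubound; exists n.
Qed.

Lemma limn_einf_ge0 (u : (\bar R)^nat) :
  (\forall n \near \oo, (0 <= u n)%E) -> (0 <= limn_einf u)%E.
Proof.
move=> h; rewrite /limn_einf oppe_ge0; apply: limn_esup_le0.
by apply: filterS h => n; rewrite oppe_le0.
Qed.

Lemma limn_einf_gt (u : (\bar R)^nat) (e : R) : (0 <= limn_einf u)%E -> 0 < e ->
  \forall n \near \oo, ((- e)%:E < u n)%E.
Proof.
rewrite /limn_einf oppe_ge0 => h e0; have := limn_esup_lt h e0.
by apply: filterS => n; rewrite EFinN lteNl.
Qed.

Lemma lipschitz_profile (m : R -> R) :
  [lipschitz m r | r in [set r : R | 0 <= r]] ->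
  exists2 C, 0 < C & forall r s, 0 <= r -> r <= s -> m s - m r <= C * (s - r).
Proof.
move=> lm; suff /filter_ex[C [C0 hC]] : \forall C \near +oo, 0 < C /\
    forall r s, 0 <= r -> r <= s -> m s - m r <= C * (s - r) by exists C.
near=> C; split; first by near: C; exact: nbhs_pinfty_gt.
move=> r s r0 rs.
have : C.-lipschitz_[set r : R | 0 <= r] m by near: C.
move/(_ (s, r)); rewrite /= (ger0_norm (x := s - r)) ?subr_ge0//.
move=> /(_ (conj (le_trans r0 rs) r0)).
exact: le_trans (ler_norm _).
Unshelve. all: by end_near. Qed.

Variables (N : nat) (sigma : 'rV[R]_N -> R) (xm : 'rV[R]_N).
Hypothesis sigma_periodic : Zperiodic sigma.
Hypothesis sigma_continuous : continuous sigma.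
Hypothesis sigma_gt0 : forall x, 0 < sigma x.
Hypothesis sigma_ge : forall x, sigma xm <= sigma x.
Implicit Types (x y z p P : 'rV[R]_N) (u v : 'rV[R]_N -> R) (a b s t : R).

Lemma Lip_continuous u : Lip_torus u -> continuous u.
Proof.
by move=> [_ /lipschitz_euclid[C C0 h]]; exact: euclid_lipschitz_continuous C0 h.
Qed.

(** Comparison in both directions leaves one critical value, so the choice made by [xget] is
    forced. *)
Lemma effective_hamiltonianE (M : R -> R) P u a :
  (forall s, 0 <= s -> 0 < M s) ->
  cell_solution (separable_hamiltonian sigma M) P u a ->
  effective_hamiltonian (separable_hamiltonian sigma M) P = a.
Proof.
move=> M0 hu; apply: xget_subset1; first by exists u.
move=> b c [v [lv [v1 v2]]] [w [lw [w1 w2]]].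
apply/eqP; rewrite eq_le; apply/andP; split.
  apply: (visc_comparison sigma_periodic sigma_continuous sigma_gt0 M0
    (proj1 lw) _ (proj1 lv) _ w1 v2); exact: Lip_continuous.
apply: (visc_comparison sigma_periodic sigma_continuous sigma_gt0 M0
  (proj1 lv) _ (proj1 lw) _ v1 w2); exact: Lip_continuous.
Qed.

Variable m : R -> R.
Hypothesis m_range : forall r, 0 <= r -> 0 < m r < 1.
Hypothesis m_lt : forall r s, 0 <= r -> r < s -> m r < m s.
Variable C : R.
Hypothesis C_gt0 : 0 < C.
Hypothesis m_lipschitz : forall r s, 0 <= r -> r <= s -> m s - m r <= C * (s - r).

Definition coercive_profile (n : nat) s := m s + Num.max 0 (s - n%:R).

Lemma coercive_profile_ge n s : m s <= coercive_profile n s.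
Proof. by rewrite lerDl le_max lexx. Qed.

Lemma coercive_profileE n s : s <= n%:R -> coercive_profile n s = m s.
Proof. by move=> sn; rewrite /coercive_profile max_l ?addr0// subr_le0. Qed.

Lemma coercive_profile_gt0 n s : 0 <= s -> 0 < coercive_profile n s.
Proof.
by move=> /m_range/andP[h _]; exact: lt_le_trans h (coercive_profile_ge n s).
Qed.

Lemma coercive_profile_lt n r s : 0 <= r -> r < s ->
  coercive_profile n r < coercive_profile n s.
Proof.
move=> r0 rs; apply: ltr_leD; first exact: m_lt.
by rewrite ge_max !le_max lexx/= lerD2r (ltW rs) orbT.
Qed.

Lemma coercive_profile_lipschitz n r s : 0 <= r -> r <= s ->
  coercive_profile n s - coercive_profile n r <= (C + 1) * (s - r).
Proof.
move=> r0 rs; rewrite /coercive_profile opprD addrACA mulrDl mul1r.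
apply: lerD; first exact: m_lipschitz.
rewrite lerBlDl ge_max; apply/andP; split.
  by rewrite addr_ge0 ?subr_ge0// le_max lexx.
have : r - n%:R <= Num.max 0 (r - n%:R) by rewrite le_max lexx orbT.
by lra.
Qed.

Lemma coercive_profile_unbounded n A :
  exists2 s, 0 <= s & A <= coercive_profile n s.
Proof.
exists (n%:R + `|A|); first by rewrite addr_ge0.
have /andP[m0 _] : 0 < m (n%:R + `|A|) < 1 by apply: m_range; rewrite addr_ge0.
have : n%:R + `|A| - n%:R <= Num.max 0 (n%:R + `|A| - n%:R).
  by rewrite le_max lexx orbT.
by have := ler_norm A; rewrite /coercive_profile; lra.
Qed.

Lemma continuous_separable (M : R -> R) :
  (forall r s, 0 <= r -> r < s -> M r < M s) ->
  (forall r s, 0 <= r -> r <= s -> M s - M r <= (C + 1) * (s - r)) ->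
  continuous_hamiltonian (separable_hamiltonian sigma M).
Proof.
move=> Mlt Mlip; split.
  by move=> x k; apply/funext => p; rewrite /separable_hamiltonian sigma_periodic.
have C1 : 0 < C + 1 by rewrite addr_gt0.
rewrite (_ : (fun _ => _) = (fun z : 'rV[R]_N * 'rV[R]_N =>
    sigma z.1 * M `|euclid_norm z.2|)); last first.
  apply/funext => z; rewrite /separable_hamiltonian ger0_norm//.
  exact: euclid_norm_ge0.
move=> z; apply: continuousM.
  exact: (continuous_comp_fst sigma_continuous).
apply: (@continuous_comp_snd _ _ _ (fun p : 'rV[R]_N => M `|euclid_norm p|)).
move=> p; apply: (continuous_comp (f := @euclid_norm R N) (g := fun r => M `|r|)).
  exact: euclid_norm_continuous.
exact: (M_normr_continuous Mlt C1 Mlip).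
Qed.

Lemma coercive_separable n :
  coercive (separable_hamiltonian sigma (coercive_profile n)).
Proof.
apply/cvgeyPge => A; near=> r.
apply: le_ereal_inf_tmp => _ [[x p] /= rp <-]; rewrite lee_fin.
have r1 : n%:R + `|A| / sigma xm <= r.
  by near: r; apply: nbhs_pinfty_ge; rewrite num_real.
apply: le_trans (ler_norm A) _.
have hA : `|A| / sigma xm <= coercive_profile n (euclid_norm p).
  have /andP[m0 _] := m_range (euclid_norm_ge0 p).
  have : euclid_norm p - n%:R <= Num.max 0 (euclid_norm p - n%:R).
    by rewrite le_max lexx orbT.
  by rewrite /coercive_profile; lra.
rewrite ler_pdivrMr// mulrC in hA; apply: le_trans hA _.
by rewrite ler_pM2r// coercive_profile_gt0// euclid_norm_ge0.
Unshelve. all: by end_near. Qed.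

(** On a ball of radius [r] the difference vanishes once [n >= r]; everywhere it is at most 0. *)
Lemma coercive_approximation :
  approximating_sequence (separable_hamiltonian sigma m)
    (fun n => separable_hamiltonian sigma (coercive_profile n)).
Proof.
split.
- move=> n; apply: continuous_separable; first exact: coercive_profile_lt.
  exact: coercive_profile_lipschitz.
- exact: coercive_separable.
- move=> r r0; apply: limn_einf_ge0; near=> n.
  apply: le_ereal_inf_tmp => _ [[x p] /= pr <-]; rewrite lee_fin.
  rewrite /separable_hamiltonian coercive_profileE ?subrr//.
  apply: le_trans pr _; near: n; exact: nbhs_infty_ger.
- apply: limn_esup_le0; near=> n.
  apply: ge_ereal_sup => _ [[x p] _ <-]; rewrite lee_fin subr_le0.
  by rewrite ler_pM2l// coercive_profile_ge.
Unshelve. all: by end_near. Qed.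

Lemma gradient_bound P u : Lip_torus u -> exists2 r, 0 <= r &
  (forall x p, superdifferential u x p -> euclid_norm (p + P) <= r) /\
  (forall x p, subdifferential u x p -> euclid_norm (p + P) <= r).
Proof.
move=> [_ /lipschitz_euclid[K K0 hK]]; exists (K + euclid_norm P).
  by rewrite addr_ge0// euclid_norm_ge0.
by split=> x p hp; apply: le_trans (euclid_normD _ _) _; rewrite lerD2r;
  [exact: superdifferential_bound hp|exact: subdifferential_bound hp].
Qed.

Lemma cell_solution_coercive P u a :
  cell_solution (separable_hamiltonian sigma m) P u a ->
  \forall n \near \oo,
    cell_solution (separable_hamiltonian sigma (coercive_profile n)) P u a.
Proof.
move=> [lu [sub sup]]; have [r r0 [hr1 hr2]] := gradient_bound P lu.
near=> n.
have rn : r <= n%:R by near: n; exact: nbhs_infty_ger.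
split=> //; split=> x p hp; rewrite /separable_hamiltonian coercive_profileE.
- exact: sub.
- exact: le_trans (hr1 _ _ hp) rn.
- exact: sup.
- exact: le_trans (hr2 _ _ hp) rn.
Unshelve. all: by end_near. Qed.

(* Touch [u] from below near a minimum point of [sigma]: its gradient is bounded
   there and [m < 1]. *)
Lemma cell_solution_lt P u a :
  cell_solution (separable_hamiltonian sigma m) P u a -> a < sigma xm.
Proof.
move=> [lu [_ sup]]; have [r r0 [_ hr]] := gradient_bound P lu.
have /andP[mr0 mr1] := m_range r0.
have : sigma xm * m r < sigma xm by rewrite gtr_pMr.
apply: le_lt_trans; rewrite leNgt; apply/negP => lt_a.
have [e e0 he] : exists2 e, 0 < e &
    forall z, cosd xm z < e -> sigma z * m r < a.
  apply: cosd_nbhs; first by move=> z k; rewrite sigma_periodic.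
  have : \forall z \near xm, sigma z < a / m r.
    apply: (@cvgr_lt _ _ (nbhs xm) _ _ _ (sigma_continuous (x := xm))).
    by rewrite ltr_pdivlMr.
  by apply: filterS => z; rewrite ltr_pdivlMr.
have [pu _] := lu; have cu := Lip_continuous lu.
have [y0 hy0] : exists y, forall z, - 1 * u z <= - 1 * u y.
  by apply: torus_max => [x k|]; [rewrite pu|exact: continuous_scale].
pose D := u xm - u y0.
have D0 : 0 <= D by rewrite /D; have := hy0 xm; lra.
(* Touching where [cosd xm >= e] would cost [D + 1], while [u] can drop below [u xm] by at most [D];
   so the contact lies where [sigma z * m r < a]. *)
pose j := (D + 1) / e.
have j0 : 0 <= j by rewrite divr_ge0 ?ltW//; lra.
have je : j * e = D + 1 by rewrite divfK ?gt_eqF.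
have [||y hy] := @torus_max R N (fun z => - 1 * u z - j * cosd xm z).
- by move=> x k; rewrite pu cosdDr.
- apply: continuous_sub; first exact: continuous_scale.
  by apply: continuous_scale; exact: cosd_continuous.
have Dy : subdifferential u y (- j *: gradient (cosd xm) y).
  exists (fun z => - j * cosd xm z); first exact/C1_scale/C1_cosd.
  split; first by move=> z; have := hy z; lra.
  by rewrite gradient_scale//; exact: differentiable_cosd.
have := sup _ _ Dy; rewrite subr_ge0 /separable_hamiltonian => hsup.
have {}hsup : a <= sigma y * m r.
  apply: le_trans hsup _; rewrite ler_pM2l//.
  have := hr _ _ Dy; rewrite le_eqVlt => /orP[/eqP ->//|].
  by move/(m_lt (euclid_norm_ge0 _))/ltW.
have ey : e <= cosd xm y.
  by rewrite leNgt; apply/negP => /he; rewrite ltNge hsup.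
have := ler_wpM2l j0 ey; rewrite je.
by have := hy xm; have := hy0 y; rewrite cosdxx /D; lra.
Qed.

End EffectiveHamiltonian.

(** * The solvability set and its critical values through the approximations *)

Unset Implicit Arguments.

Theorem theorem3p2 (R : realType) (N : nat) (hN : (0 < N)%N)
  (sigma : 'rV[R]_N -> R) (m : R -> R) (sigma_min : R) (Hinf : 'rV[R]_N -> R)
  (sigma_periodic : Zperiodic sigma)
  (sigma_continuous : continuous sigma)
  (sigma_gt0 : forall x, 0 < sigma x)
  (m_range : forall r, 0 <= r -> 0 < m r < 1)
  (m_lipschitz : [lipschitz m r | r in [set r : R | 0 <= r]])
  (m_increasing : forall r s, 0 <= r -> r < s -> m r < m s)
  (m_lim : m r @[r --> +oo%R] --> (1 : R))
  (sigma_minP : range sigma sigma_min /\ lbound (range sigma) sigma_min)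
  (HinfP : is_generalized_effective_hamiltonian
             (separable_hamiltonian sigma m) Hinf) :
  solvability_set (separable_hamiltonian sigma m) = [set P | Hinf P < sigma_min] /\
  (forall P, solvability_set (separable_hamiltonian sigma m) P ->
     critical_values (separable_hamiltonian sigma m) P = [set Hinf P]).
Proof.
have [[xm _ smin_eq] smin_lb] := sigma_minP.
have sigma_ge x : sigma xm <= sigma x by rewrite smin_eq; apply: smin_lb; exists x.
have [xM sigma_le] := torus_max sigma_periodic sigma_continuous.
have [C C0 m_lip] : exists2 C, 0 < C &
    forall r s, 0 <= r -> r <= s -> m s - m r <= C * (s - r).
  exact: lipschitz_profile m_lipschitz.
pose Hn n := separable_hamiltonian sigma (coercive_profile m n).
have Hn_approx : approximating_sequence (separable_hamiltonian sigma m) Hn.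
  exact: (coercive_approximation sigma_periodic sigma_continuous sigma_gt0
    sigma_ge m_range m_increasing C0 m_lip).
have eff_cvg P e : 0 < e -> \forall n \near \oo,
    `|Hinf P - effective_hamiltonian (Hn n) P| < e.
  move=> e0; have [hinf hsup] := HinfP _ Hn_approx.
  (* This radius is positive and its ball contains [P], so the locally uniform lower bound applies
     at [P]. *)
  have hP : 0 < euclid_norm P + 1 by rewrite ltr_wpDl// euclid_norm_ge0.
  near=> n; rewrite ltr_norml; apply/andP; split.
    rewrite -lte_fin; apply: (@lt_le_trans _ _ (ereal_inf
      [set (Hinf Q - effective_hamiltonian (Hn n) Q)%:E |
        Q in [set Q | euclid_norm Q <= euclid_norm P + 1]])).
      by near: n; exact: limn_einf_gt (hinf _ hP) e0.
    by apply: ereal_inf_lbound; exists P => //=; rewrite lerDl.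
  rewrite -lte_fin; apply: (@le_lt_trans _ _ (ereal_sup
    [set (Hinf Q - effective_hamiltonian (Hn n) Q)%:E | Q in setT])).
    by apply: ereal_sup_ubound; exists P.
  by near: n; exact: limn_esup_lt hsup e0.
(* The same [u] and [a] solve the cell problems of all late [Hn n], whose effective Hamiltonians at
   [P] are thus eventually [a]. *)
have critical_eq P u a : cell_solution (separable_hamiltonian sigma m) P u a ->
    Hinf P = a.
  move=> hu; apply/eqP; rewrite -subr_eq0 -normr_eq0; apply/eqP.
  apply/eqP; rewrite eq_le normr_ge0 andbT; apply/ler_addgt0Pr => e e0.
  rewrite add0r.
  have : \forall n \near \oo, `|Hinf P - a| < e.
    near=> n; rewrite -(effective_hamiltonianE (M := coercive_profile m n)
      sigma_periodic sigma_continuous sigma_gt0 _ (u := u) (P := P) (a := a)).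
    - by near: n; exact: eff_cvg.
    - exact: coercive_profile_gt0.
    - near: n; exact: (cell_solution_coercive hu).
  by move=> /filter_ex[n /ltW].
have solvable P : Hinf P < sigma_min ->
    solvability_set (separable_hamiltonian sigma m) P.
  move=> ltP.
  pose e := (sigma_min - Hinf P) / 2.
  have e0 : 0 < e by rewrite divr_gt0// subr_gt0.
  have smin0 : 0 < sigma_min by rewrite -smin_eq.
  (* The midpoint of [Hinf P] and [sigma_min] separates the late critical values from
     [sigma_min * m n%:R], which tends to [sigma_min]. *)
  have [n [hn1 hn2]] : exists n,
      `|Hinf P - effective_hamiltonian (Hn n) P| < e /\
      (sigma_min + Hinf P) / 2 < sigma_min * m n%:R.
    have : \forall n \near \oo, `|Hinf P - effective_hamiltonian (Hn n) P| < e /\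
        (sigma_min + Hinf P) / 2 < sigma_min * m n%:R.
      near=> n; split; first by near: n; exact: eff_cvg.
      rewrite (mulrC sigma_min) -ltr_pdivrMr//; near: n.
      have h : nbhs +oo%R [set r | (sigma_min + Hinf P) / 2 / sigma_min < m r].
        apply: (@cvgr_gt _ _ _ _ _ _ m_lim).
        by rewrite ltr_pdivrMr// mul1r; lra.
      exact: (cvgr_idn h).
    by move/filter_ex.
  have [u [a hu]] := cell_solution_exists P sigma_periodic sigma_continuous
    sigma_gt0 sigma_ge sigma_le (coercive_profile_gt0 m_range n)
    (coercive_profile_lt m_increasing n) (ltr_wpDl (ltW C0) ltr01)
    (coercive_profile_lipschitz m_lip n) (coercive_profile_unbounded m_range n).
  rewrite (effective_hamiltonianE sigma_periodic sigma_continuous sigma_gt0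
    (coercive_profile_gt0 m_range n) hu) in hn1.
  have an : a < sigma_min * m n%:R.
    by move: hn1; rewrite ltr_norml /e => /andP[h _]; lra.
  have [lu [sub sup]] := hu; exists u, a; split=> //; split=> x p hp.
    have := sub x p hp; apply: le_trans; rewrite lerD2r ler_pM2l//.
    exact: coercive_profile_ge.
  have [pn|pn] := leP (euclid_norm (p + P)) n%:R.
    by have := sup x p hp; rewrite /separable_hamiltonian coercive_profileE.
  (* Beyond radius [n] the inequality holds for every covector, as [a] lies below
     [sigma_min * m n%:R]. *)
  rewrite subr_ge0 (le_trans (ltW an))//; apply: ler_pM => //.
  - exact: ltW.
  - by have /andP[/ltW] := m_range _ (ler0n R n).
  - by rewrite -smin_eq.
  - by apply/ltW/m_increasing.
split.
  apply/seteqP; split=> P /=; last exact: solvable.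
  move=> [u [a hu]]; rewrite (critical_eq _ _ _ hu) -smin_eq.
  exact: (cell_solution_lt xm sigma_periodic sigma_continuous sigma_gt0 m_range
    m_increasing hu).
move=> P [u [a hu]]; apply/seteqP; split=> b /=.
  by move=> [v hv]; rewrite (critical_eq _ _ _ hv).
by move=> ->; rewrite (critical_eq _ _ _ hu); exists u.
Unshelve. all: by end_near. Qed.
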